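(* Let $n\ge 1$, $d\ge 1$, and suppose that $g_1,\dots,g_n$ is a regular sequence of homogeneous degree $d$ polynomials in $\mathbb{C}[x_1,\dots,x_n]$. Then the associated form \[ \mathbf{A}(g_1,\dots,g_n)\in \mathbf{P}\bigl(\mathbb{C}[\partial/\partial x_1,\dots,\partial/\partial x_n]_{n(d-1)}\bigr) \] is semistable with respect to the $\operatorname{SL}(n)$-action. In particular, for every smooth form $F\in\mathbb{C}[x_1,\dots,x_n]_{d+1}$, the associated form of the regular sequence $\partial F/\partial x_1,\dots,\partial F/\partial x_n$ is semistable.
   Context: We work over $\mathbb{C}$. Let $V$ be the vector space with basis $x_1,\dots,x_n$, let $S=\operatorname{Sym}V=\mathbb{C}[x_1,\dots,x_n]$, and let $\partial/\partial x_1,\dots,\partial/\partial x_n$ be the dual basis of $V^\vee$. $\mathbf{P}(E)$ denotes the space of lines in a vector space $E$. The polar (apolarity) pairing $\mathbb{C}[\partial/\partial x_1,\dots,\partial/\partial x_n]_m\times \mathbb{C}[x_1,\dots,x_n]_m\to\mathbb{C}$, given by letting differential operators act on polynomials, is perfect and identifies $\mathbb{C}[\partial/\partial x_1,\dots,\partial/\partial x_n]_m=\operatorname{Sym}^m V^\vee$ with $(\operatorname{Sym}^m V)^\vee$, $\operatorname{SL}(V)$-equivariantly. If $g_1,\dots,g_n$ is a regular sequence of degree $d$ forms, then $S/(g_1,\dots,g_n)$ is a graded local Artinian Gorenstein algebra with socle in degree $n(d-1)$, so $(g_1,\dots,g_n)_{n(d-1)}$ has codimension $1$ in $\mathbb{C}[x_1,\dots,x_n]_{n(d-1)}$.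 The associated form $\mathbf{A}(g_1,\dots,g_n)$ is the line of elements of $\mathbb{C}[\partial/\partial x_1,\dots,\partial/\partial x_n]_{n(d-1)}$ that annihilate $(g_1,\dots,g_n)_{n(d-1)}$ under the polar pairing. $\operatorname{SL}(n)=\operatorname{SL}(V)$ acts on $\operatorname{Sym}^{m}V^\vee$ via the natural action on $V^\vee$ dual to that on $V$. A point of $\mathbf{P}(\operatorname{Sym}^m V^\vee)$ is semistable if the closure of the $\operatorname{SL}(V)$-orbit of a nonzero vector on the corresponding line does not contain $0$. A form $F\in \mathbb{C}[x_1,\dots,x_n]_{d+1}$ is smooth if its first partial derivatives have no common zero in $\mathbf{P}V^\vee$; equivalently, they form a regular sequence. *)

(* Defs.v *)
From mathcomp Require Import all_boot all_order all_algebra.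
From mathcomp Require Export reals.
From mathcomp Require Export mpoly.
From mathcomp.real_closed Require Export complex.

Set Implicit Arguments.
Unset Strict Implicit.
Unset Printing Implicit Defensive.

Import GRing.Theory.

Local Open Scope ring_scope.

Section RegularSequences.
Variables (n : nat) (K : fieldType).
Implicit Types (s : seq {mpoly K[n]}) (p : {mpoly K[n]}).

Definition in_ideal s p : Prop :=
  exists q : nat -> {mpoly K[n]}, p = \sum_(i < size s) q i * s`_i.

Definition regular_seq s : Prop :=
  (forall i h, (i < size s)%N ->
     in_ideal (take i s) (h * s`_i) -> in_ideal (take i s) h)
  /\ ~ in_ideal s 1.

(* A point of the projective space of lines in the dual of the span of the
   variables is represented by a nonzero vector of coordinates. *)
Definition smooth_form p : Prop :=
  forall v : 'I_n -> K, (forall i, (p^`M(i)).@[v] = 0) -> forall i, v i = 0.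

(* [F] is read as a polynomial in the partial derivatives, the variable 'X_i
   of [F] standing for d/dx_i.  When [F] and [p] are homogeneous of the same
   degree, F(d/dx) p is a constant and taking its constant term loses
   nothing. *)
Definition polar (F p : {mpoly K[n]}) : K :=
  (\sum_(m <- msupp F) F@_m *: p^`M[m])@_0%MM.

End RegularSequences.

Section Projective.
Variables (K : fieldType) (vT : vectType K).

Record proj := Proj { line :> {vspace vT}; _ : \dim line == 1%N }.

Definition zariski_closure (X : vT -> Prop) (w : vT) : Prop :=
  forall f : {mpoly K[\dim {:vT}]},
    (forall x, X x -> f.@[fun i => coord (vbasis {:vT}) i x] = 0) ->
    f.@[fun i => coord (vbasis {:vT}) i w] = 0.

End Projective.
Arguments proj {K} vT.

Section SpecialLinearAction.
Variables (n : nat) (K : fieldType) (m : nat).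
Implicit Types (A : 'M[K]_n.+1) (F : dhomog n.+1 K m).

(* [A] sends the basis vector x_j to \sum_i A i j x_i, hence the dual basis
   vector d/dx_j to \sum_i (A^-1) j i d/dx_i. *)
Definition dual_subst A : n.+1.-tuple {mpoly K[n.+1]} :=
  [tuple \sum_i invmx A j i *: 'X_i | j < n.+1].

Fact dual_act_homog A F : (F : {mpoly K[n.+1]}) \mPo dual_subst A \is m.-homog.
Proof.
have : (F : {mpoly K[n.+1]}) \is m.-homog by exact: dhomog_is_dhomog.
move: {F}(F : {mpoly _[_]}) => p /dhomogP p_homog.
rewrite comp_mpolyE big_seq; apply: rpred_sum => e /p_homog <-.
apply: dhomogZ; rewrite /= mdegE.
elim/big_rec2: _ => [|i q k _ hq]; first exact: dhomog1.
apply: dhomogM hq.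
have : tnth (dual_subst A) i \is 1.-homog.
  rewrite tnth_mktuple; apply: rpred_sum => j _; apply: dhomogZ.
  by rewrite dhomogX /= mdeg1.
by move/(dhomogMn (e i)); rewrite mul1n.
Qed.

Definition dual_act A F : dhomog n.+1 K m := DHomog (dual_act_homog A F).

Definition SL_orbit F : dhomog n.+1 K m -> Prop :=
  fun G => exists2 A : 'M[K]_n.+1, \det A = 1 & G = dual_act A F.

(* Closure is meant in the Zariski topology.  Over the complex numbers the
   Zariski and Euclidean closures of an orbit coincide. *)
Definition semistable (L : proj (dhomog n.+1 K m)) : Prop :=
  forall F, F \in line L -> F != 0 -> ~ zariski_closure (SL_orbit F) 0.

End SpecialLinearAction.

Definition is_associated_form (n : nat) (K : fieldType) (d : nat)
    (g : seq {mpoly K[n.+1]})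
    (L : proj (dhomog n.+1 K (n.+1 * d.-1))) : Prop :=
  forall F, F \in line L <->
    (forall p, p \is (n.+1 * d.-1).-homog -> in_ideal g p -> polar F p = 0).
Arguments is_associated_form {n K} d g L.

(* Main.v *)
Require Import Defs.
From HB Require Import structures.
From mathcomp Require Import all_boot all_order all_algebra.
From mathcomp Require Import perm boolp classical_sets zify.

Set Implicit Arguments.
Unset Strict Implicit.
Unset Printing Implicit Defensive.

Import GRing.Theory Num.Theory.

Local Open Scope ring_scope.
Local Open Scope complex_scope.

(** Write [N] for [n.+1] and [S] for the ring of polynomials in [N] variables. The first
    ingredient is commutative algebra. Let [g] consist of [N] forms of degree [d] such that
    [S/(g)] is Artinian: regular sequences are so by their Hilbert function
    ([regular_seq_artinian]), and the partial derivatives of a smooth form by a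
    Nullstellensatz ([projective_nullstellensatz]), which is deduced from the existence of
    eigenvalues. The variables form a regular sequence, and they can be replaced one by one
    by linear combinations of the [g] without losing regularity ([exchange_variables]).
    Every stage has the Hilbert function of a complete intersection. The last stage shows
    that [(g)] has codimension one in degree [N (d-1)], which gives the associated form
    ([associated_form_exists]). The intermediate ones show that, modulo the first [N - r]
    variables, [(g)] contains all forms of degree more than [r (d-1)]
    ([in_ideal_large_degree]).

    It follows that a nonzero form [F] of degree [N (d-1)] apolar to [(g)] contains a
    monomial [x^a] with [a_0 + .. + a_(j-1) >= j (d-1)] for all [j]
    ([exists_heavy_monomial]). For weights [w_0 <= w_1 <= ..] of sum zero, such a monomial
    has weight at most zero. As the hypotheses on [g] are stable under linear changes of
    coordinates ([polar_lin_subst], [lin_subst_artinian]), this says that [F] passes the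
    numerical criterion for every one-parameter subgroup of the special linear group.

    The second ingredient replaces one-parameter subgroups by places, so as to reach the
    Zariski closure of the orbit directly. Let [Y] be the generic matrix. If [0] is in the
    closure of the orbit of [F], the coefficients of [F(Y x) / det(Y)^(d-1)] can be
    specialized to [0], and this specialization extends to a valuation ring, with residue
    field [C], of the field generated by the entries of [Y] ([place_extension]). Over this
    ring [Y] is [P * diag t * Q] with [P] and [Q] invertible ([smith_valuation]): the
    matrix [Q] can be dropped, [P] specializes to an invertible matrix over [C], and the
    criterion above, applied to [t] after the change of coordinates [P], contradicts the
    vanishing of the specialized coefficients ([no_destabilizing_place]). *)

(** * Ideals generated by forms *)

Section Ideals.
Variables (n : nat) (K : fieldType).
Implicit Types (s t : seq {mpoly K[n]}) (p q y : {mpoly K[n]}).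

Lemma in_ideal_rcons s y p :
  in_ideal (rcons s y) p <-> exists q, in_ideal s (p - q * y).
Proof.
split=> [[q ->]|[q [r def_p]]].
  exists (q (size s)), q; rewrite size_rcons big_ord_recr /= nth_rcons ltnn eqxx.
  by rewrite addrK; apply: eq_bigr => i _; rewrite nth_rcons ltn_ord.
exists (fun i => if i == size s then q else r i).
rewrite size_rcons big_ord_recr /= nth_rcons ltnn !eqxx.
rewrite -[p](subrK (q * y)) def_p; congr (_ + _); apply: eq_bigr => i _.
by rewrite nth_rcons ltn_ord ltn_eqF.
Qed.

Lemma in_ideal0 s : in_ideal s 0.
Proof. by exists (fun=> 0); rewrite big1 // => i _; rewrite mul0r. Qed.

Lemma in_idealD s p q : in_ideal s p -> in_ideal s q -> in_ideal s (p + q).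
Proof.
case=> a -> [b ->]; exists (fun i => a i + b i).
by rewrite -big_split; apply: eq_bigr => i _; rewrite mulrDl.
Qed.

Lemma in_idealMl s p q : in_ideal s p -> in_ideal s (q * p).
Proof.
case=> a ->; exists (fun i => q * a i).
by rewrite mulr_sumr; apply: eq_bigr => i _; rewrite mulrA.
Qed.

Lemma in_idealMr s p q : in_ideal s p -> in_ideal s (p * q).
Proof. by rewrite mulrC; apply: in_idealMl. Qed.

Lemma in_idealN s p : in_ideal s p -> in_ideal s (- p).
Proof. by move=> /(in_idealMl (-1)); rewrite mulN1r. Qed.

Lemma in_idealB s p q : in_ideal s p -> in_ideal s q -> in_ideal s (p - q).
Proof. by move=> sp sq; apply/in_idealD/in_idealN. Qed.

Lemma in_idealBC s p q : in_ideal s (p - q) -> in_ideal s (q - p).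
Proof. by move/in_idealN; rewrite opprB. Qed.

Lemma in_ideal_eqv s p q : in_ideal s (p - q) -> in_ideal s q -> in_ideal s p.
Proof. by move=> spq sq; rewrite -(subrK q p); apply: in_idealD. Qed.

Lemma in_idealZ s c p : in_ideal s p -> in_ideal s (c *: p).
Proof. by move=> sp; rewrite -mul_mpolyC; apply: in_idealMl. Qed.

Lemma in_ideal_sum s (I : Type) (r : seq I) (P : pred I) F :
  (forall i, P i -> in_ideal s (F i)) -> in_ideal s (\sum_(i <- r | P i) F i).
Proof.
move=> sF; elim/big_ind: _ => //; first exact: in_ideal0.
by move=> p q; apply: in_idealD.
Qed.

Lemma in_ideal_mem s y : y \in s -> in_ideal s y.
Proof.
move=> ys; exists (fun i => (i == index y s)%:R).
have lt_ys : (index y s < size s)%N by rewrite index_mem.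
rewrite (bigD1 (Ordinal lt_ys)) //= eqxx mul1r nth_index //.
rewrite big1 ?addr0 // => i; rewrite -val_eqE /= => /negbTE ->.
by rewrite mul0r.
Qed.

Lemma in_ideal_ind s (P : {mpoly K[n]} -> Prop) :
  P 0 -> (forall p q, P p -> P q -> P (p + q)) ->
  (forall q y, y \in s -> P (q * y)) -> forall p, in_ideal s p -> P p.
Proof.
move=> P0 PD PM p [q ->]; elim/big_ind: _ => // i _.
by apply: PM; apply: mem_nth.
Qed.

Lemma in_ideal_trans s t : (forall y, y \in s -> in_ideal t y) ->
  forall p, in_ideal s p -> in_ideal t p.
Proof.
move=> st; apply: in_ideal_ind; first exact: in_ideal0.
  by move=> p q; apply: in_idealD.
by move=> q y /st; apply: in_idealMl.
Qed.

Lemma in_ideal_subset s t : {subset s <= t} ->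
  forall p, in_ideal s p -> in_ideal t p.
Proof. by move=> st; apply: in_ideal_trans => y /st; apply: in_ideal_mem. Qed.

Lemma in_ideal_catl s t p : in_ideal s p -> in_ideal (s ++ t) p.
Proof. by apply: in_ideal_subset => y; rewrite mem_cat => ->. Qed.

Lemma in_ideal_catr s t p : in_ideal t p -> in_ideal (s ++ t) p.
Proof. by apply: in_ideal_subset => y; rewrite mem_cat orbC => ->. Qed.

Lemma in_ideal_expB s p q k :
  in_ideal s (p - q) -> in_ideal s (p ^+ k - q ^+ k).
Proof. by rewrite subrXX; apply: in_idealMr. Qed.

Lemma in_ideal_eqvM s p p' q q' : in_ideal s (p - p') -> in_ideal s (q - q') ->
  in_ideal s (p * q - p' * q').
Proof.
move=> spp sqq; have -> : p * q - p' * q' = (p - p') * q + p' * (q - q').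
  by rewrite mulrBl mulrBr addrA subrK.
by apply: in_idealD; [apply: in_idealMr | apply: in_idealMl].
Qed.

(** Positive degrees make the inductions on the degree terminate. *)
Definition forms s := forall y, y \in s -> exists2 e, (0 < e)%N & y \is e.-homog.

Lemma forms_cat s t : forms (s ++ t) <-> forms s /\ forms t.
Proof.
split=> [hst | [hs ht] y]; last by rewrite mem_cat => /orP[/hs|/ht].
by split=> y ys; apply: hst; rewrite mem_cat ys ?orbT.
Qed.

Lemma forms_rcons s e y : (0 < e)%N -> y \is e.-homog -> forms s -> forms (rcons s y).
Proof.
by move=> e0 hy hs z; rewrite mem_rcons inE => /predU1P[-> | /hs //]; exists e.
Qed.

Lemma pihomogMr m e q y : y \is e.-homog ->
  pihomog mdeg m (q * y) =
    if (e <= m)%N then pihomog mdeg (m - e) q * y else 0.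
Proof.
move=> hy; rewrite {1}[q]mpolyE mulr_suml linear_sum /=.
have hX a : ('X_[K, a] * y) \is (mdeg a + e)%N.-homog.
  by apply: dhomogM hy; rewrite dhomogX.
case: ifPn => [le_em | lt_me].
  rewrite {3}[q]mpolyE linear_sum mulr_suml /=; apply: eq_bigr => a _.
  rewrite -scalerAl !linearZ /= -scalerAl pihomogX; congr (_ *: _).
  case: eqP => [ma | ma].
    by apply: pihomog_dE; rewrite -(subnK le_em) -ma.
  rewrite mul0r; apply: (pihomog_ne0 _ (hX a)).
  by apply/eqP => mae; apply: ma; rewrite -mae addnK.
apply: big1 => a _; rewrite -scalerAl linearZ /= (pihomog_ne0 _ (hX a)) ?scaler0 //.
by apply: contra lt_me => /eqP <-; rewrite leq_addl.
Qed.

Lemma in_ideal_pihomog s m p : forms s -> in_ideal s p ->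
  in_ideal s (pihomog mdeg m p).
Proof.
move=> hs; elim/in_ideal_ind.
- by rewrite pihomog0; apply: in_ideal0.
- by move=> {}p q sp sq; rewrite pihomogD; apply: in_idealD.
move=> q y ys; have [e _ hy] := hs y ys; rewrite (pihomogMr _ _ hy).
by case: ifP => _; [apply/in_idealMl/in_ideal_mem | apply: in_ideal0].
Qed.

(** Taking the component of degree [m] of a decomposition of [p] leaves a homogeneous
    coefficient on [y]; for [m] below the degree of [y] there is no room for it. This
    is what lets degrees decrease in the graded arguments below. *)
Lemma in_ideal_rcons_homog s e y m p : forms s -> y \is e.-homog ->
  p \is m.-homog -> in_ideal (rcons s y) p ->
  if (e <= m)%N then exists2 q, q \is (m - e).-homog & in_ideal s (p - q * y)
  else in_ideal s p.
Proof.
move=> hs hy hp /in_ideal_rcons[q /(in_ideal_pihomog m hs)].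
rewrite linearB /= (pihomog_dE hp) (pihomogMr _ _ hy).
case: ifP => _; last by rewrite subr0.
by exists (pihomog mdeg (m - e) q) => //; apply: pihomogP.
Qed.

End Ideals.

(** * Hilbert functions and regular sequences of forms *)

(** A subspace of largest dimension inside [P] is all of [P], since any further vector
    of [P] would enlarge it. *)
Lemma vspace_of_pred (K : fieldType) (vT : vectType K) (P : vT -> Prop) :
  P 0 -> (forall c u v, P u -> P v -> P (c *: u + v)) ->
  exists U : {vspace vT}, forall v, v \in U <-> P v.
Proof.
move=> P0 PL.
have step k (U : {vspace vT}) : (forall v, v \in U -> P v) ->
    (\dim {:vT} <= \dim U + k)%N -> exists U : {vspace vT}, forall v, v \in U <-> P v.
  elim: k U => [|k IHk] U PU dimU.
    exists U => v; split=> [/PU // | _]; suff -> : U = fullv by rewrite memvf.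
    by apply/eqP; rewrite eqEdim subvf -[\dim U]addn0.
  have [UP | ] := pselect (forall v, P v -> v \in U).
    by exists U => v; split=> [/PU | /UP].
  move=> /existsNP[v /not_implyP[Pv /negP U'v]].
  apply: (IHk (U + <[v]>)%VS).
    move=> _ /memv_addP[u /PU Pu [_ /vlineP[c ->] ->]].
    by rewrite addrC; apply: PL.
  apply: leq_trans dimU _; rewrite addnS -addSn leq_add2r.
  rewrite ltn_neqAle dimvS ?addvSl // andbT (dimv_leqif_sup (addvSl _ _)).2.
  by apply: contra U'v => /subvP->; rewrite // memvE addvSr.
apply: (step (\dim {:vT}) 0%VS) => [v|]; last by rewrite leq_addl.
by rewrite memv0 => /eqP->.
Qed.

(** Both sides count the dimension of the image of [f] in the quotient by [W]. *)
Lemma dim_img_preim (K : fieldType) (aT rT : vectType K) (f : 'Hom(aT, rT))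
    (W : {vspace rT}) :
  (\dim (limg f + W) + \dim (f @^-1: W) = \dim W + \dim {:aT})%N.
Proof.
have sub_ker : (lker f <= f @^-1: W)%VS.
  by apply/subvP => v; rewrite memv_ker -memv_preim => /eqP->; rewrite mem0v.
have := limg_ker_dim f (f @^-1: W); rewrite (capv_idPr sub_ker).
rewrite -[in (f @: _)%VS]lpreim_cap_limg lpreimK ?capvSr //.
have := limg_ker_dim f fullv; rewrite capfv.
have := dimv_sum_cap (limg f) W; rewrite capvC.
by lia.
Qed.

Section Hilbert.
Variables (n : nat) (K : fieldType).
Implicit Types (s t : seq {mpoly K[n.+1]}) (p q y h : {mpoly K[n.+1]}).
Local Notation V := (dhomog n.+1 K).

Lemma ideal_part_subproof s m :
  {U : {vspace V m} | forall p : V m, p \in U <-> in_ideal s p}.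
Proof.
apply: cid; apply: vspace_of_pred; first exact: in_ideal0.
by move=> c u v su sv; apply/in_idealD/sv/in_idealZ.
Qed.

Definition ideal_part s m := sval (ideal_part_subproof s m).

Lemma ideal_partP s m (p : V m) : p \in ideal_part s m <-> in_ideal s p.
Proof. exact: (svalP (ideal_part_subproof s m)). Qed.

Definition hilbert s m := (\dim {:V m} - \dim (ideal_part s m))%N.

Lemma hilbert_eqv s t m : (forall p, in_ideal s p <-> in_ideal t p) ->
  hilbert s m = hilbert t m.
Proof.
move=> st; congr (_ - \dim _)%N.
by apply/vspaceP => p; apply/idP/idP => /ideal_partP/st/ideal_partP.
Qed.

Lemma hilbert_eq0 s m :
  hilbert s m = 0%N <-> forall p, p \is m.-homog -> in_ideal s p.
Proof.
split=> [/eqP | sm].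
  rewrite subn_eq0 => dimV p hp; apply/(ideal_partP s (DHomog hp)).
  have /eqP-> : ideal_part s m == fullv by rewrite eqEdim subvf.
  exact: memvf.
apply/eqP; rewrite subn_eq0; apply/dimvS/subvP => p _.
by apply/ideal_partP/sm/(valP p).
Qed.

Fact mul_form_homog m e (y : V e) (p : V m) :
  (p : {mpoly _[_]}) * (y : {mpoly _[_]}) \is (m + e).-homog.
Proof. by apply: dhomogM; apply: dhomog_is_dhomog. Qed.

Definition mul_form m e (y : V e) (p : V m) : V (m + e) := DHomog (mul_form_homog y p).

Lemma mul_form_linear m e (y : V e) : linear (@mul_form m e y).
Proof.
by move=> c p q; apply: val_inj; rewrite /= mulrDl scalerAl.
Qed.

HB.instance Definition _ m e (y : V e) :=
  GRing.isLinear.Build K (V m) (V (m + e)) _ (@mul_form m e y) (@mul_form_linear m e y).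

(** The defect [k] is the dimension of the kernel of multiplication by [y] on the part
    of degree [m] of [S / (s)], where [S] is the polynomial ring. *)
Lemma hilbert_rcons_ker s y e m : forms s -> y \is e.-homog ->
  exists k, [/\ (hilbert (rcons s y) (m + e) + hilbert s m = hilbert s (m + e) + k)%N
    & k = 0%N <-> forall h, h \is m.-homog -> in_ideal s (h * y) -> in_ideal s h].
Proof.
move=> hs hy; pose f := linfun (mul_form (DHomog hy) : V m -> V (m + e)).
have fE (p : V m) : val (f p) = val p * y by rewrite lfunE.
pose W := ideal_part s (m + e).
have def_sy : ideal_part (rcons s y) (m + e) = (limg f + W)%VS.
  apply/vspaceP => p; apply/idP/idP => [/ideal_partP | ].
    move/(in_ideal_rcons_homog hs hy (valP p)); rewrite leq_addl addnK.
    case=> q hq sqp; rewrite -(subrK (f (DHomog hq)) p) addrC.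
    apply: memv_add; first exact: memv_img (memvf _).
    by apply/ideal_partP; rewrite [X in in_ideal _ X]/= fE.
  case/memv_addP=> _ /memv_imgP[q _ ->] [r /ideal_partP sr ->]; apply/ideal_partP.
  by apply/in_ideal_rcons; exists (val q); rewrite /= fE addrC addKr.
have preP (p : V m) : p \in (f @^-1: W)%VS <-> in_ideal s (val p * y).
  by rewrite -memv_preim; split=> [/ideal_partP | ?]; last apply/ideal_partP; rewrite -?fE // fE.
have sub_pre : (ideal_part s m <= f @^-1: W)%VS.
  by apply/subvP => p /ideal_partP sp; apply/preP/in_idealMr.
exists (\dim (f @^-1: W) - \dim (ideal_part s m))%N; split.
  have arith (r k w b a u : nat) : (r + k = w + b -> u <= k -> k <= b -> r <= a ->
      w <= r -> a - r + (b - u) = a - w + (k - u))%N by lia.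
  apply: arith (dimvS sub_pre) (dimvS (subvf _)) (dimvS (subvf _)) _.
    by rewrite def_sy dim_img_preim.
  by rewrite def_sy dimvS ?addvSr.
split=> [/eqP | inj_y].
  rewrite subn_eq0 => le_dim h hh shy; apply/(ideal_partP s (DHomog hh)).
  have /eqP-> : ideal_part s m == (f @^-1: W)%VS by rewrite eqEdim sub_pre.
  exact/preP.
apply/eqP; rewrite subn_eq0; apply/dimvS/subvP => p /preP spy.
by apply/ideal_partP; apply: (inj_y _ (valP p)).
Qed.

Lemma hilbert_rcons_lt s y e m : forms s -> y \is e.-homog -> (m < e)%N ->
  hilbert (rcons s y) m = hilbert s m.
Proof.
move=> hs hy lt_me; congr (_ - \dim _)%N.
apply/vspaceP => p; apply/idP/idP => /ideal_partP sp; apply/ideal_partP.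
  by have := in_ideal_rcons_homog hs hy (valP p) sp; rewrite leqNgt lt_me.
by rewrite -cats1; apply: in_ideal_catl.
Qed.

(** Testing homogeneous [h] is enough for ideals generated by forms, and it is the
    form in which regularity is compared with Hilbert functions. *)
Definition nonzerodiv s y :=
  forall m h, h \is m.-homog -> in_ideal s (h * y) -> in_ideal s h.

Definition regular_forms s := forall i, (i < size s)%N -> nonzerodiv (take i s) s`_i.

Lemma regular_forms_rcons s y : regular_forms (rcons s y) <-> regular_forms s /\ nonzerodiv s y.
Proof.
split=> [reg | [reg nzy] i].
  split=> [i lt_is|]; last first.
    have := reg (size s); rewrite size_rcons ltnSn nth_rcons ltnn eqxx.
    by rewrite -cats1 take_size_cat //; apply.
  have := reg i; rewrite size_rcons nth_rcons lt_is ltnW // -cats1.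
  by rewrite takel_cat 1?ltnW //; apply.
rewrite size_rcons ltnS leq_eqVlt nth_rcons -cats1 => /predU1P[-> | lt_is].
  by rewrite ltnn eqxx take_size_cat.
by rewrite lt_is takel_cat 1?ltnW //; apply: reg.
Qed.

Lemma nonzerodiv_eqv s t y : (forall p, in_ideal s p <-> in_ideal t p) ->
  nonzerodiv s y -> nonzerodiv t y.
Proof. by move=> st nzy m h hh /st /(nzy m h hh) /st. Qed.

(** Graded Nakayama: a homogeneous [h] killed by [b] modulo [u] is a multiple of [a]
    modulo [u], and its cofactor, of smaller degree, is again killed by [b]. Hence the
    kernel of [b] is zero, and the two elements can be exchanged. *)
Lemma nonzerodiv_swap u a b e e' : forms u -> (0 < e)%N -> a \is e.-homog ->
  b \is e'.-homog -> nonzerodiv u a -> nonzerodiv (rcons u a) b ->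
  nonzerodiv u b /\ nonzerodiv (rcons u b) a.
Proof.
move=> hu e_gt0 ha hb nza nzb.
have nzub : nonzerodiv u b.
  elim/ltn_ind=> m IHm h hh uhb.
  have uah : in_ideal (rcons u a) h.
    by apply: nzb hh _; rewrite -cats1; apply: in_ideal_catl.
  have := in_ideal_rcons_homog hu ha hh uah; case: ifP => // le_em [q hq uhq].
  apply: (in_ideal_eqv uhq); apply: in_idealMr.
  apply: (IHm (m - e)%N _ _ hq); first by rewrite ltn_subrL e_gt0 (leq_trans e_gt0).
  apply: (nza _ _ (dhomogM hq hb)).
  have -> : q * b * a = h * b - (h - q * a) * b.
    by rewrite mulrBl opprB addrC subrK -!mulrA [b * a]mulrC.
  by apply: in_idealB => //; apply: in_idealMr.
split=> // m h hh ubha.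
have := in_ideal_rcons_homog hu hb (dhomogM hh ha) ubha.
case: ifP => [le_e' [q hq uq] | _ uha]; last first.
  by rewrite -cats1; apply: in_ideal_catl; apply: nza hh uha.
have uaq : in_ideal (rcons u a) q.
  apply: nzb hq _; rewrite -(subKr (h * a) (q * b)).
  apply: in_idealB; first by apply/in_idealMl/in_ideal_mem; rewrite mem_rcons mem_head.
  by rewrite -cats1; apply: in_ideal_catl.
have := in_ideal_rcons_homog hu ha hq uaq; case: ifP => [le_e [r hr ur] | _ uqq].
  apply/in_ideal_rcons; exists r; apply: (nza m).
    apply: rpredB => //; have -> : m = (m + e - e' - e + e')%N by lia.
    exact: dhomogM.
  have -> : (h - r * b) * a = (h * a - q * b) + (q - r * a) * b.
    by rewrite !mulrBl addrA subrK -!mulrA [b * a]mulrC.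
  by apply: in_idealD => //; apply: in_idealMr.
rewrite -cats1; apply: in_ideal_catl; apply: (nza _ _ hh).
by apply: in_ideal_eqv uq _; apply: in_idealMr.
Qed.

(** Moving [a] past the elements of [t], one [nonzerodiv_swap] at a time. *)
Lemma regular_forms_drop s a t : forms (s ++ a :: t) -> regular_forms (s ++ a :: t) ->
  regular_forms (s ++ t) /\ nonzerodiv (s ++ t) a.
Proof.
elim/last_ind: t => [|t b IHt]; first by rewrite cats1 cats0 => _ /regular_forms_rcons.
rewrite -rcons_cons -!rcons_cat => hsat /regular_forms_rcons[reg nzb].
have hsat' : forms (s ++ a :: t) by move=> y ys; apply: hsat; rewrite mem_rcons inE ys orbT.
have [reg' nza] := IHt hsat' reg.
have [|e e0 ha] := hsat a; first by rewrite mem_rcons inE mem_cat mem_head !orbT.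
have [|e' e'0 hb] := hsat b; first by rewrite mem_rcons mem_head.
have hst : forms (s ++ t).
  by move=> y ys; apply: hsat'; rewrite mem_cat inE orbCA -mem_cat ys orbT.
have [] := nonzerodiv_swap hst e0 ha hb nza.
  apply: nonzerodiv_eqv nzb => p; split; apply: in_ideal_subset => y;
  by rewrite mem_rcons inE !mem_cat inE orbCA.
by move=> nzub nzuba; split=> //; apply/regular_forms_rcons.
Qed.

(** Hilbert functions are extended by zero to negative degrees, so that multiplying the
    Hilbert series by [1 - t^e] is [delta e], and by [1 + t + .. + t^(d-1)] is
    [window_sum d], without side conditions. *)
Definition hilbert_int s (z : int) : int := if z is Posz m then (hilbert s m)%:Z else 0.
Definition delta (e : nat) (f : int -> int) := fun z : int => f z - f (z - e%:Z).
Definition window_sum (d : nat) (f : int -> int) := fun z : int => \sum_(j < d) f (z - j%:Z).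

Lemma hilbert_int_rcons s y e : forms s -> y \is e.-homog -> nonzerodiv s y ->
  hilbert_int (rcons s y) = delta e (hilbert_int s).
Proof.
move=> hs hy nzy; apply/funext => -[m | m]; rewrite /delta; last first.
  by case def_z: (Negz m - e%:Z) => [k|k] /=; [lia | rewrite subr0].
have [lt_me | le_em] := ltnP m e.
  rewrite /= (hilbert_rcons_lt hs hy lt_me).
  by case def_z: (Posz m - e%:Z) => [k|k] /=; [lia | rewrite subr0].
have -> : Posz m - e%:Z = Posz (m - e) by lia.
have [k [def_k k0]] := hilbert_rcons_ker (m - e) hs hy.
have {}k0 : k = 0%N by apply/k0/nzy.
by move: def_k; rewrite k0 subnK // /=; lia.
Qed.

(** The factorization [1 - t^d = (1 + t + .. + t^(d-1)) (1 - t)]. *)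
Lemma delta_window_sum d f : delta d f = window_sum d (delta 1 f).
Proof.
apply/funext => z; rewrite /window_sum /delta; elim: d => [|d IHd].
  by rewrite big_ord0 subr0 subrr.
rewrite big_ord_recr /= -IHd -addrA addKr.
by congr (_ - f _); lia.
Qed.

Lemma delta1_window_sum d f : delta 1 (window_sum d f) = window_sum d (delta 1 f).
Proof.
apply/funext => z; rewrite /window_sum /delta sumrB; congr (_ - _).
by apply: eq_bigr => j _; congr f; lia.
Qed.

Lemma iter_delta d r f : iter r (delta d) f = iter r (window_sum d) (iter r (delta 1) f).
Proof.
elim: r => //= r ->; rewrite delta_window_sum; congr window_sum.
elim: r (iter r _ f) => //= r IHr g.
by rewrite delta1_window_sum IHr.
Qed.

(** The polynomial [(1 + t + .. + t^(d-1))^r] is monic of degree [r (d-1)]. *)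
Lemma iter_window_sum_dirac d r f : (0 < d)%N -> (forall z, f z = (z == 0)%:Z) ->
  iter r (window_sum d) f (r * d.-1)%:Z = 1 /\
  forall z : int, z > (r * d.-1)%:Z -> iter r (window_sum d) f z = 0.
Proof.
case: d => // d _ fE; elim: r => [|r [IH1 IH0]] /=.
  by split=> [|z z_gt0]; rewrite fE //; case: eqP => // z0; move: z_gt0; rewrite z0.
split=> [|z lt_z]; last first.
  by rewrite /window_sum big1 // => j _; apply: IH0; have := ltn_ord j; lia.
rewrite /window_sum big_ord_recr /= big1 => [|j _]; last first.
  by apply: IH0; have := ltn_ord j; lia.
by rewrite add0r -[RHS]IH1; congr (iter _ _ _ _); lia.
Qed.

Definition first_vars k : seq {mpoly K[n.+1]} := mkseq (fun i => 'X_(inord i)) k.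

Lemma size_first_vars k : size (first_vars k) = k. Proof. exact: size_mkseq. Qed.

Lemma first_varsS k : first_vars k.+1 = rcons (first_vars k) 'X_(inord k).
Proof. by rewrite /first_vars /mkseq -[in iota _ _]addn1 iotaD map_cat cats1. Qed.

Lemma mem_first_vars k (i : 'I_n.+1) : (i < k)%N -> 'X_i \in first_vars k.
Proof.
move=> lt_ik; apply/mapP; exists (i : nat); last by rewrite inord_val.
by rewrite mem_iota.
Qed.

Lemma first_vars_homog k y : y \in first_vars k -> y \is 1.-homog.
Proof. by case/mapP=> i _ ->; rewrite dhomogX /= mdeg1. Qed.

Lemma forms_first_vars k : forms (first_vars k).
Proof. by move=> y /first_vars_homog hy; exists 1%N. Qed.

(** The ideal of the first [k] variables is spanned by the monomials that involve one
    of them. *)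
Lemma in_ideal_first_vars k p : (k <= n.+1)%N ->
  in_ideal (first_vars k) p <->
  forall m : 'X_{1..n.+1}, (forall i : 'I_n.+1, (i < k)%N -> m i = 0%N) -> p@_m = 0.
Proof.
move=> le_kn; split=> [|p0].
  elim/in_ideal_ind.
  - by move=> m _; rewrite mcoeff0.
  - by move=> {}p q p0 q0 m m0; rewrite mcoeffD p0 // q0 // addr0.
  move=> q y yX m m0; case/mapP: yX => i; rewrite mem_iota /= add0n => lt_ik ->.
  apply/eqP; rewrite mcoeff_eq0 (perm_mem (msuppMX _ _)).
  apply/mapP=> -[m' _ def_m]; have := m0 (inord i).
  by rewrite def_m mnmDE mnm1E eqxx inordK ?(leq_trans lt_ik) // => /(_ isT).
rewrite [p]mpolyE big_seq; apply: in_ideal_sum => m pm; apply: in_idealZ.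
have [i lt_ik mi] : exists2 i : 'I_n.+1, (i < k)%N & m i != 0%N.
  apply: contraPP (mcoeff_msupp p m) => no_i; rewrite pm => /esym/eqP; apply.
  apply: p0 => i lt_ik; apply/eqP; apply: contraPT isT => mi; case: no_i.
  by exists i.
have {mi} le_im : (U_(i) <= m)%MM by rewrite lep1mP.
by rewrite -(submK le_im) mpolyXD; apply/in_idealMl/in_ideal_mem/mem_first_vars.
Qed.

Lemma regular_first_vars k : (k <= n.+1)%N -> regular_forms (first_vars k).
Proof.
elim: k => [|k IHk] le_kn; first by case.
rewrite first_varsS; apply/regular_forms_rcons; split=> [|m h _]; first exact/IHk/ltnW.
move/(in_ideal_first_vars _ (ltnW le_kn)) => hX0.
apply/(in_ideal_first_vars _ (ltnW le_kn)) => a a0.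
rewrite -(mcoeffMX _ U_(inord k)); apply: hX0 => i lt_ik.
rewrite mnmDE a0 // mnm1E -val_eqE /= inordK //.
by rewrite addn0 gtn_eqF.
Qed.

Lemma hilbert_first_vars m : hilbert (first_vars n.+1) m = (m == 0%N).
Proof.
case: m => [|m] /=; last first.
  apply/hilbert_eq0 => p hp; apply/(in_ideal_first_vars _ (leqnn _)) => a a0.
  apply: (dhomog_nemf_coeff hp); rewrite /= mdegE big1 // => i _.
  exact: a0.
rewrite /hilbert; have -> : ideal_part (first_vars n.+1) 0 = 0%VS.
  apply/vspaceP => p; rewrite memv0; apply/idP/eqP => [/ideal_partP | ->]; last exact: mem0v.
  move/(in_ideal_first_vars _ (leqnn _)) => p0; apply/val_inj/mpolyP => a /=.
  rewrite mcoeff0; have [-> | a0] := eqVneq a 0%MM.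
    by apply: p0 => i _; rewrite mnm0E.
  by apply: (dhomog_nemf_coeff (valP p)); rewrite /= mdeg_eq0.
by rewrite dimv0 subn0 dimvf /dim /= bin0.
Qed.

Lemma hilbert_int_cat s d (h : seq {mpoly K[n.+1]}) :
  (0 < d)%N -> forms s -> (forall y, y \in h -> y \is d.-homog) ->
  regular_forms (s ++ h) -> hilbert_int (s ++ h) = iter (size h) (delta d) (hilbert_int s).
Proof.
move=> d_gt0 hs; elim/last_ind: h => [|h y IHh] hh; first by rewrite cats0.
rewrite -rcons_cat => /regular_forms_rcons[reg nzy].
have hh' z : z \in h -> z \is d.-homog by move=> zh; apply: hh; rewrite mem_rcons inE zh orbT.
have hy : y \is d.-homog by apply: hh; rewrite mem_rcons mem_head.
rewrite (hilbert_int_rcons _ hy nzy) ?size_rcons /= ?IHh //.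
by apply/forms_cat; split=> // z /hh' hilbert_int; exists d.
Qed.

(** Writing [N] for [n.+1] and [H] for the Hilbert series of the polynomial ring, the
    sequence has series [(1-t^d)^r (1-t)^(N-r) H = (1 + .. + t^(d-1))^r (1-t)^N H], and
    [(1-t)^N H = 1] because the variables form a regular sequence too. *)
Theorem hilbert_regular d r (h : seq {mpoly K[n.+1]}) : (0 < d)%N -> (r <= n.+1)%N -> size h = r ->
  (forall y, y \in h -> y \is d.-homog) -> regular_forms (first_vars (n.+1 - r) ++ h) ->
  hilbert (first_vars (n.+1 - r) ++ h) (r * d.-1) = 1%N /\
  forall m, (r * d.-1 < m)%N -> hilbert (first_vars (n.+1 - r) ++ h) m = 0%N.
Proof.
move=> d_gt0 le_rn sz_h hh reg.
have hzX k : (k <= n.+1)%N -> hilbert_int (first_vars k) = iter k (delta 1) (hilbert_int [::]).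
  move=> le_kn; rewrite -(cat0s (first_vars k)) (hilbert_int_cat (d := 1)) ?size_first_vars //.
    exact: first_vars_homog.
  exact: regular_first_vars.
have := hilbert_int_cat d_gt0 (@forms_first_vars _) hh reg; rewrite sz_h hzX ?leq_subr //.
rewrite iter_delta -iterD subnKC // -hzX //.
have [] := @iter_window_sum_dirac d r (hilbert_int (first_vars n.+1)) d_gt0.
  by case=> m; rewrite /hilbert_int // hilbert_first_vars; case: m.
move=> A1 A0 def_h; split=> [|m lt_m].
  by have := congr1 (@^~ (r * d.-1)%:Z) def_h; rewrite /= A1 => -[].
by have := congr1 (@^~ m%:Z) def_h; rewrite /= A0 // => -[].
Qed.

End Hilbert.

(** * Artinian quotients and complete intersections *)

Section Artinian.
Variables (n : nat) (K : fieldType).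
Implicit Types (s t g : seq {mpoly K[n.+1]}) (p q y z : {mpoly K[n.+1]}).
Local Notation V := (dhomog n.+1 K).

(** For ideals generated by forms this says that the quotient has finite dimension, or,
    over an algebraically closed field, that the forms have no common zero but the
    origin. *)
Definition artinian s := forall i, exists k, in_ideal s ('X_i ^+ k).

Lemma artinian_trans s t : (forall y, y \in s -> in_ideal t y) -> artinian s -> artinian t.
Proof. by move=> st sX i; have [k sXk] := sX i; exists k; apply: in_ideal_trans sXk. Qed.

(** A monomial of large degree has a large exponent. *)
Lemma artinian_hilbert s : artinian s -> exists m0, forall m, (m0 <= m)%N -> hilbert s m = 0%N.
Proof.
move=> /choice[k sX]; exists (\sum_i k i)%N => m le_km; apply/hilbert_eq0 => p hp.
rewrite [p]mpolyE big_seq; apply: in_ideal_sum => a /(dhomog_mf hp) /= deg_a.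
apply: in_idealZ; have [i le_ki] : exists i, (k i <= a i)%N.
  apply: contraPP le_km => no_i; apply/negP; rewrite -ltnNge -deg_a mdegE.
  have lt_ak i : (a i < k i)%N by rewrite ltnNge; apply/negP => ?; apply: no_i; exists i.
  rewrite 2!big_ord_recl -addSn leq_add ?lt_ak //; apply: leq_sum => i _.
  exact/ltnW/lt_ak.
have le_ma : (U_(i) *+ k i <= a)%MM.
  apply/mnm_lepP => j; rewrite mulmnE mnm1E.
  by case: eqP => [<- | _]; rewrite ?mul1n.
by rewrite -(submK le_ma) mpolyXD -mpolyXn; apply/in_idealMl/sX.
Qed.

Lemma hilbert0_artinian s m : hilbert s m = 0%N -> artinian s.
Proof.
move/hilbert_eq0=> sm i; exists m; apply: sm.
by rewrite -[X in X.-homog]mul1n dhomogMn // dhomogX /= mdeg1.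
Qed.

(** If a power of [x_i] is congruent to [q z], its [k]-th power is congruent to
    [q^k z^k]. *)
Lemma artinian_pow s z k : in_ideal s (z ^+ k) -> artinian (rcons s z) -> artinian s.
Proof.
move=> szk sX i; have [j /in_ideal_rcons[q sXj]] := sX i.
exists (j * k)%N; rewrite exprM; apply: in_ideal_eqv (in_ideal_expB k sXj) _.
by rewrite exprMn; apply: in_idealMl.
Qed.

(** In large degrees multiplication by [l] is onto modulo [s]. *)
Lemma hilbert_eventually_le s l : forms s -> l \is 1.-homog -> artinian (rcons s l) ->
  exists m0, forall m k, (m0 <= m)%N -> (hilbert s (m + k) <= hilbert s m)%N.
Proof.
move=> hs hl /artinian_hilbert[m0 sl0]; exists m0 => m k le_m.
elim: k => [|k IHk]; first by rewrite addn0.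
apply: leq_trans IHk; have [j [+ _]] := hilbert_rcons_ker (m + k) hs hl.
by rewrite sl0 addn1 -addnS; lia.
Qed.

(** The quotient by [s] has dimension one: its Hilbert function is eventually constant,
    so multiplication by [h], which is onto in large degrees, is bijective there. An
    element killed by [h] is thus killed by a power of [l], hence zero. *)
Lemma nonzerodiv_exchange s l h d : forms s -> l \is 1.-homog -> nonzerodiv s l ->
  artinian (rcons s l) -> h \is d.-homog -> artinian (rcons s h) -> nonzerodiv s h.
Proof.
move=> hs hl nzl artl hh arth.
have [m0 le_hilb] := hilbert_eventually_le hs hl artl.
have le_hilb' m k : (hilbert s m <= hilbert s (m + k))%N.
  elim: k => [|k IHk]; first by rewrite addn0.
  apply: leq_trans IHk _; have [j [+ [_ j0]]] := hilbert_rcons_ker (m + k) hs hl.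
  by rewrite (j0 (nzl _)) addn1 addnS; lia.
have [m1 sh0] := artinian_hilbert arth.
have inj m u : (m0 + m1 <= m)%N -> u \is m.-homog -> in_ideal s (u * h) -> in_ideal s u.
  move=> le_m; have [k [+ [k0 _]]] := hilbert_rcons_ker m hs hh.
  rewrite sh0; last lia; have := le_hilb m d; have := le_hilb' m d => ? ? ?.
  apply: k0; lia.
(* Multiplying by this power of [l] reaches the degrees where [inj] applies. *)
move=> m u hu suh; have {suh} : in_ideal s (u * l ^+ (m0 + m1)).
  apply: (inj (m + (m0 + m1))%N); first exact: leq_addl.
    by apply: dhomogM hu _; rewrite -[X in X.-homog]mul1n dhomogMn.
  by rewrite mulrAC; apply: in_idealMr.
elim: (m0 + m1)%N => [|k IHk]; first by rewrite mulr1.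
rewrite exprSr mulrA => /nzl-/(_ (m + k)%N) sulk; apply/IHk/sulk.
by apply: dhomogM hu _; rewrite -[X in X.-homog]mul1n dhomogMn.
Qed.

(** There are [e.+1] elements in a quotient space of dimension at most [e]. *)
Lemma dependent_mod s m e (v : nat -> {mpoly K[n.+1]}) :
  (forall i, (i <= e)%N -> v i \is m.-homog) -> (hilbert s m <= e)%N ->
  exists p : {poly K}, [/\ p != 0, (size p <= e.+1)%N
    & in_ideal s (\sum_(i < e.+1) p`_i *: v i)].
Proof.
move=> hv le_e.
have hf (c : 'rV[K]_e.+1) : \sum_i c 0 i *: v i \is m.-homog.
  by apply: rpred_sum => i _; apply/rpredZ/hv; rewrite -ltnS.
pose f0 c : V m := DHomog (hf c).
have f_lin : linear f0.
  move=> a b c; apply: val_inj; rewrite /= scaler_sumr -big_split /=.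
  by apply: eq_bigr => i _; rewrite !mxE scalerDl scalerA.
pose fL := GRing.isLinear.Build _ _ _ _ f0 f_lin.
pose f : {linear 'rV[K]_e.+1 -> V m} := HB.pack f0 fL.
pose U := (linfun f @^-1: ideal_part s m)%VS.
have nzU : U != 0%VS.
  have := dim_img_preim (linfun f) (ideal_part s m); rewrite -/U -dimv_eq0.
  have := dimvS (subvf (limg (linfun f) + ideal_part s m)); move: le_e; rewrite /hilbert.
  have -> : \dim {:'rV[K]_e.+1} = e.+1 by rewrite dimvf /dim /= mul1n.
  have arith (a b c k : nat) : (a - b <= e -> c <= a -> c + k = b + e.+1 -> k != 0)%N.
    by lia.
  exact: arith.
have := memv_pick U; rewrite -memv_preim => /ideal_partP; rewrite lfunE /= => sU.
exists (\poly_(i < e.+1) vpick U 0 (inord i)); split; last 1 first.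
- suff -> : \sum_(i < e.+1) (\poly_(i0 < e.+1) vpick U 0 (inord i0))`_i *: v i =
            \sum_i vpick U 0 i *: v i by [].
  by apply: eq_bigr => i _; rewrite coef_poly ltn_ord inord_val.
- apply: contra nzU; rewrite -vpick0 => /eqP p0; apply/eqP/rowP => i.
  by move/polyP: p0 => /(_ i); rewrite coef_poly ltn_ord inord_val coef0 mxE.
exact: size_poly.
Qed.

End Artinian.

Section CompleteIntersection.
Variables (n : nat) (K : numFieldType).
Implicit Types (s t g : seq {mpoly K[n.+1]}) (p q y z : {mpoly K[n.+1]}).

Lemma poly_nonroot (p : {poly K}) : p != 0 -> exists c, p.[c] != 0.
Proof.
move=> nz_p; apply: contrapT => all_root.
pose rs : seq K := [seq i%:R | i <- iota 0 (size p)].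
have := @max_poly_roots K p rs nz_p; rewrite size_map size_iota ltnn.
suff -> : all (root p) rs.
  rewrite map_inj_uniq ?iota_uniq => [/(_ isT isT) // | i j /eqP].
  by rewrite eqr_nat => /eqP.
apply/allP=> _ /mapP[i _ ->]; apply: contrapT => nr.
by apply: all_root; exists i%:R; apply/negP.
Qed.

(** Noether normalization for two forms. As the Hilbert function does not exceed [e] in
    degree [d * e], the [e.+1] monomials of degree [e] in [z1] and [z2] satisfy a
    relation [p] modulo [s]. Modulo [z1 - c z2] it reads [p(c) z2^e = 0], and [c] is
    chosen with [p(c) != 0]. *)
Lemma noether_pair s t d e z1 z2 : z1 \is d.-homog -> z2 \is d.-homog ->
  (hilbert s (d * e) <= e)%N -> artinian (s ++ z1 :: z2 :: t) ->
  exists c, artinian (s ++ (z1 - c *: z2) :: t).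
Proof.
move=> hz1 hz2 le_e art.
have [|p [nz_p sz_p sp]] := dependent_mod (v := fun i => z1 ^+ i * z2 ^+ (e - i)) _ le_e.
  move=> i le_ie; have -> : (d * e = d * i + d * (e - i))%N by rewrite -mulnDr subnKC.
  by rewrite dhomogM ?dhomogMn.
have [c nz_pc] := poly_nonroot nz_p; exists c.
set w := z1 - _; set s' := s ++ _.
have s'w : in_ideal s' w by apply/in_ideal_catr/in_ideal_mem/mem_head.
have s'z2 : in_ideal s' (z2 ^+ e).
  rewrite -[z2 ^+ e]scale1r -(mulVf nz_pc) -scalerA; apply: in_idealZ.
  apply: in_ideal_eqv (in_ideal_catl _ sp); apply: in_idealBC.
  rewrite (horner_coef_wide c sz_p) scaler_suml -sumrB.
  apply: in_ideal_sum => i _; rewrite -scalerA -scalerBr; apply: in_idealZ.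
  have -> : z2 ^+ e = z2 ^+ i * z2 ^+ (e - i) by rewrite -exprD subnKC // -ltnS.
  rewrite scalerAl -mulrBl; apply: in_idealMr.
  by rewrite -exprZn; apply: in_ideal_expB.
apply: artinian_pow s'z2 _; apply: artinian_trans art => y.
have memr x : x \in s' -> in_ideal (rcons s' z2) x.
  by move=> xs; apply: in_ideal_mem; rewrite mem_rcons inE xs orbT.
have s'z : in_ideal (rcons s' z2) z2 by apply: in_ideal_mem; rewrite mem_rcons mem_head.
rewrite mem_cat !inE => /or4P[ys | /eqP-> | /eqP-> // | yt].
- by apply: memr; rewrite mem_cat ys.
- rewrite -(subrK (c *: z2) z1); apply: in_idealD; last exact: in_idealZ.
  by apply: memr; rewrite mem_cat mem_head orbT.
by apply: memr; rewrite mem_cat inE yt !orbT.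
Qed.

(** Iterating [noether_pair] makes a single combination [h] sufficient. The forms that
    were eliminated are kept in [t'], so that nothing is lost from the ideal. *)
Lemma noether_reduce s d e z t : (forall y, y \in z :: t -> y \is d.-homog) ->
  (hilbert s (d * e) <= e)%N -> artinian (s ++ z :: t) ->
  exists h t', [/\ size t' = size t, forall y, y \in h :: t' -> y \is d.-homog,
    artinian (rcons s h) & forall p, in_ideal (h :: t') p <-> in_ideal (z :: t) p].
Proof.
elim: t z => [|z2 t IHt] z1 hzt le_e art.
  by exists z1, [::]; split=> //; rewrite -cats1.
have hz1 : z1 \is d.-homog by apply: hzt; rewrite inE eqxx.
have hz2 : z2 \is d.-homog by apply: hzt; rewrite !inE eqxx orbT.
have [c art'] := noether_pair hz1 hz2 le_e art.
have [y|h [t' [sz_t' ht' arth eq_ht']]] := IHt (z1 - c *: z2) _ le_e art'.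
  rewrite inE => /predU1P[-> | yt]; first by rewrite rpredB ?rpredZ.
  by apply: hzt; rewrite !inE yt !orbT.
have mem x u : x \in u -> in_ideal u x by apply: in_ideal_mem.
exists h, (z2 :: t'); split=> [|y||p] //; first by rewrite /= sz_t'.
  by rewrite !inE orbCA => /predU1P[-> // | yt]; apply: ht'.
have ht'E y : y \in h :: t' -> in_ideal (z1 - c *: z2 :: t) y by move/mem/eq_ht'.
have ztE y : y \in z1 - c *: z2 :: t -> in_ideal (h :: t') y by move/mem/eq_ht'.
have sub1 : forall q, in_ideal (z1 - c *: z2 :: t) q -> in_ideal [:: z1, z2 & t] q.
  apply: in_ideal_trans => y; rewrite inE => /predU1P[-> | yt].
    by apply: in_idealB; last apply: in_idealZ; apply: mem; rewrite !inE eqxx ?orbT.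
  by apply: mem; rewrite !inE yt !orbT.
have sub2 : forall q, in_ideal (h :: t') q -> in_ideal [:: h, z2 & t'] q.
  by apply: in_ideal_subset => y; rewrite !inE => /orP[-> | ->]; rewrite ?orbT.
split; apply: in_ideal_trans => y; rewrite !inE.
  rewrite orbCA => /predU1P[-> | ]; first by apply: mem; rewrite !inE eqxx orbT.
  by move/ht'E/sub1.
case/or3P=> [/eqP-> | /eqP-> | yt].
- rewrite -(subrK (c *: z2) z1); apply: in_idealD.
    by apply/sub2/ztE/mem_head.
  by apply/in_idealZ/mem; rewrite !inE eqxx orbT.
- by apply: mem; rewrite !inE eqxx orbT.
by apply/sub2/ztE; rewrite inE yt orbT.
Qed.

(** Steinitz exchange between the variables and the [g]. The variable that leaves is
    moved to the end of the regular sequence by [regular_forms_drop]; without it the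
    quotient has bounded Hilbert function, so [noether_reduce] finds a combination of
    the remaining generators that can take its place by [nonzerodiv_exchange]. *)
Theorem exchange_variables d g : (0 < d)%N -> size g = n.+1 ->
  (forall y, y \in g -> y \is d.-homog) -> artinian g ->
  forall r, (r <= n.+1)%N -> exists h t,
    [/\ size h = r, size t = (n.+1 - r)%N, forall y, y \in h ++ t -> y \is d.-homog,
        forall p, in_ideal (h ++ t) p <-> in_ideal g p
      & regular_forms (first_vars n K (n.+1 - r) ++ h)].
Proof.
move=> d_gt0 sz_g hg artg; elim=> [|r IHr] le_rn.
  by exists [::], g; rewrite cats0 subn0; split=> //; apply: regular_first_vars.
have [h [t [sz_h sz_t hht eq_ht reg]]] := IHr (ltnW le_rn).
pose k := (n.+1 - r.+1)%N; have def_k : (n.+1 - r)%N = k.+1 by rewrite /k; lia.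
rewrite -/k; move: reg; rewrite def_k first_varsS cat_rcons => reg.
set x := 'X_(inord k) in reg; pose s := first_vars n K k ++ h.
have hx : x \is 1.-homog by rewrite dhomogX /= mdeg1.
have hh y : y \in h -> y \is d.-homog by move=> yh; apply: hht; rewrite mem_cat yh.
have hs : forms s.
  by apply/forms_cat; split=> [|y /hh hy]; [apply: forms_first_vars | exists d].
have hxs : forms (first_vars n K k ++ x :: h).
  move=> y; rewrite mem_cat inE orbCA -mem_cat => /predU1P[-> | /hs //].
  by exists 1%N.
have [reg_s nzx] := regular_forms_drop hxs reg.
have eq_xs p : in_ideal (rcons s x) p <-> in_ideal (first_vars n K k.+1 ++ h) p.
  by split; apply: in_ideal_subset => y;
    rewrite first_varsS cat_rcons mem_rcons mem_cat !inE mem_cat orbCA.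
have artx : artinian (rcons s x).
  have reg' : regular_forms (first_vars n K (n.+1 - r) ++ h) by rewrite def_k first_varsS cat_rcons.
  have [_ hilb0] := hilbert_regular d_gt0 (ltnW le_rn) sz_h hh reg'.
  have := hilb0 _ (ltnSn _); rewrite def_k -(hilbert_eqv _ eq_xs); exact: hilbert0_artinian.
case def_t: t sz_t => [|z t0] sz_t; first by move: sz_t; rewrite /= def_k.
have [m0 le_hilb] := hilbert_eventually_le hs hx artx.
(* In degree [d * e >= m0] the Hilbert function is at most its value at [m0]. *)
pose e := maxn m0 (hilbert s m0).
have le_e : (hilbert s (d * e) <= e)%N.
  have le_m0 : (m0 <= d * e)%N by rewrite (leq_trans (leq_maxl m0 (hilbert s m0))) // leq_pmull.
  rewrite -(subnKC le_m0); apply: leq_trans (le_hilb _ _ (leqnn _)) _.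
  exact: leq_maxr.
have art_st : artinian (s ++ z :: t0).
  apply: artinian_trans artg => y /in_ideal_mem /eq_ht.
  by rewrite def_t -catA; apply: in_ideal_catr.
have [|h' [t' [sz_t' hht' arth' eq_ht']]] := noether_reduce _ le_e art_st.
  by move=> y yt; apply: hht; rewrite mem_cat def_t yt orbT.
have hh' : h' \is d.-homog by apply: hht'; rewrite mem_head.
have nzh' := nonzerodiv_exchange hs hx nzx artx hh' arth'.
exists (rcons h h'), t'; split.
- by rewrite size_rcons sz_h.
- by rewrite sz_t'; move: sz_t; rewrite /= def_k => -[].
- move=> y; rewrite cat_rcons mem_cat => /orP[/hh //|]; exact: hht'.
- move=> p; rewrite cat_rcons -eq_ht def_t.
  split; apply: in_ideal_trans => y; rewrite mem_cat => /orP[yh|].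
  + by apply/in_ideal_catl/in_ideal_mem.
  + by move/in_ideal_mem/eq_ht'; apply: in_ideal_catr.
  + by apply/in_ideal_catl/in_ideal_mem.
  by move/in_ideal_mem/eq_ht'; apply: in_ideal_catr.
by rewrite -rcons_cat; apply/regular_forms_rcons.
Qed.

Section Consequences.
Variables (d : nat) (g : seq {mpoly K[n.+1]}).
Hypotheses (d_gt0 : (0 < d)%N) (sz_g : size g = n.+1).
Hypotheses (hg : forall y, y \in g -> y \is d.-homog) (artg : artinian g).

(** Together with the first [n.+1 - r] variables, some [r] combinations of the [g] form a
    regular sequence, whose Hilbert function vanishes in these degrees. *)
Lemma in_ideal_large_degree r m p : (r <= n.+1)%N -> (r * d.-1 < m)%N ->
  p \is m.-homog -> in_ideal (first_vars n K (n.+1 - r) ++ g) p.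
Proof.
move=> le_rn lt_m hp.
have [h [t [sz_h _ hht eq_ht reg]]] := exchange_variables d_gt0 sz_g hg artg le_rn.
have hh y : y \in h -> y \is d.-homog by move=> yh; apply: hht; rewrite mem_cat yh.
have [_ /(_ m lt_m)/hilbert_eq0/(_ p hp)] := hilbert_regular d_gt0 le_rn sz_h hh reg.
apply: in_ideal_trans => y; rewrite mem_cat => /orP[yX | yh].
  by apply/in_ideal_catl/in_ideal_mem.
by apply/in_ideal_catr/eq_ht/in_ideal_catl/in_ideal_mem.
Qed.

(** At the last stage of the exchange the forms generate [(g)] itself. *)
Lemma hilbert_socle : hilbert g (n.+1 * d.-1) = 1%N.
Proof.
have [h [t [sz_h sz_t hht eq_ht reg]]] := exchange_variables d_gt0 sz_g hg artg (leqnn _).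
move: sz_t; rewrite subnn => /size0nil t0; move: hht eq_ht; rewrite t0 cats0 => hh eq_ht.
have [+ _] := hilbert_regular d_gt0 (leqnn _) sz_h hh reg.
by rewrite subnn -(hilbert_eqv _ eq_ht).
Qed.

End Consequences.

Lemma regular_seq_artinian d g : (0 < d)%N -> size g = n.+1 ->
  (forall y, y \in g -> y \is d.-homog) -> regular_seq g -> artinian g.
Proof.
move=> d_gt0 sz_g hg [reg _].
have := @hilbert_regular _ _ d n.+1 g d_gt0 (leqnn _) sz_g hg; rewrite subnn.
case=> [i lt_i m h _ | _ /(_ _ (ltnSn _))/hilbert0_artinian //]; exact: reg.
Qed.

End CompleteIntersection.

(** * The projective Nullstellensatz *)

Section Nullstellensatz.
Variables (n : nat) (K : numClosedFieldType).
Implicit Types (s t g : seq {mpoly K[n.+1]}) (u x y z : {mpoly K[n.+1]}).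
Implicit Types (p q : {poly K}).

(** The homogenization of [p] in degree [k], evaluated at [y] and [x]. *)
Definition binary_form p k x y := \sum_(i < k.+1) p`_i *: (y ^+ i * x ^+ (k - i)).

Lemma binary_formS p k x y : (size p <= k.+1)%N ->
  binary_form p k.+1 x y = binary_form p k x y * x.
Proof.
move=> sz_p; rewrite /binary_form big_ord_recr /= nth_default // scale0r addr0.
rewrite mulr_suml; apply: eq_bigr => i _.
by rewrite -scalerAl -mulrA -exprSr subSn // -ltnS.
Qed.

Lemma binary_formM q c k x y : (size q <= k.+1)%N ->
  binary_form (q * ('X - c%:P)) k.+1 x y = binary_form q k x y * (y - c *: x).
Proof.
move=> sz_q; rewrite [RHS]mulrBr -scalerAr -(binary_formS _ _ sz_q).
rewrite /binary_form scaler_sumr mulr_suml.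
under eq_bigr => i _ do rewrite mulrBr coefB coefMX coefMC scalerBl.
rewrite sumrB; congr (_ - _); last first.
  by apply: eq_bigr => i _; rewrite scalerA mulrC.
rewrite big_ord_recl /= scale0r add0r; apply: eq_bigr => i _.
by rewrite /bump /= add1n /= subSS -scalerAl exprSr mulrAC.
Qed.

(** If [s] were not Artinian, multiplication by [x] would identify all the graded parts
    of large degree of the quotient by [s] with one nonzero space of finite dimension,
    on which [y / x] acts. For an eigenvalue [c] of this operator, [y - c x] fails to be
    injective, hence to be onto, in all large degrees. *)
Lemma artinian_pencil s x y : forms s -> x \is 1.-homog -> y \is 1.-homog ->
  artinian (rcons s x) -> (forall c, artinian (rcons s (y - c *: x))) -> artinian s.
Proof.
move=> hs hx hy artx arty.
have [m0 le_hilb] := hilbert_eventually_le hs hx artx.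
have [m0' sx0] := artinian_hilbert artx.
have [m1 [le_m0 le_m0' stable]] : exists m1, [/\ (m0 <= m1)%N, (m0' <= m1)%N
    & forall k, hilbert s (m1 + k) = hilbert s m1].
  pose P e := `[< exists2 m, (m0 + m0' <= m)%N & hilbert s m = e >].
  have exP : exists e, P e by exists (hilbert s (m0 + m0')); apply/asboolP; exists (m0 + m0')%N.
  case: (ex_minnP exP) => e /asboolP[m le_m def_e] min_e; exists m; split; try lia.
  move=> k; apply/eqP; rewrite eqn_leq le_hilb /=; last lia.
  rewrite def_e; apply: min_e; apply/asboolP; exists (m + k)%N => //; lia.
have inj_at w m : w \is 1.-homog -> (m1 <= m)%N -> hilbert (rcons s w) m.+1 = 0%N ->
    forall u, u \is m.-homog -> in_ideal s (u * w) -> in_ideal s u.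
  move=> hw le_m sw0; have [k [+ [k0 _]]] := hilbert_rcons_ker m hs hw.
  have := stable (m - m1)%N; have := stable (m - m1).+1.
  by rewrite addn1 sw0 addnS subnKC // => -> -> def_k; apply: k0; lia.
have injx m : (m1 <= m)%N ->
    forall u, u \is m.-homog -> in_ideal s (u * x) -> in_ideal s u.
  by move=> le_m; apply: (inj_at x m hx le_m); apply: sx0; lia.
have hlin c : y - c *: x \is 1.-homog by rewrite rpredB ?rpredZ.
have [s0 | ] := eqVneq (hilbert s m1) 0%N; first exact: hilbert0_artinian s0.
move=> /eqP/hilbert_eq0/existsNP[u /not_implyP[hu s'u]].
(* The eigenvector: factor the relation [p] and stop at the first factor that kills. *)
have eigen k p m v : (m1 <= m)%N -> v \is m.-homog -> ~ in_ideal s v -> p != 0 ->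
    (size p <= k.+1)%N -> in_ideal s (v * binary_form p k x y) ->
    exists c m' v', [/\ (m1 <= m')%N, v' \is m'.-homog, ~ in_ideal s v'
      & in_ideal s (v' * (y - c *: x))].
  elim: k p m v => [|k IHk] p m v le_m hv s'v nz_p sz_p spv.
    case: s'v; move: spv; rewrite /binary_form big_ord1 mulr1.
    have p0 : p`_0 != 0.
      apply: contra nz_p => /eqP p0; rewrite (size1_polyC sz_p) p0; exact/eqP.
    rewrite -scalerAr mulr1 => /(in_idealZ (p`_0)^-1).
    by rewrite scalerA mulVf // scale1r.
  have [sz_p' | sz_p'] := leqP (size p) k.+1.
    apply: (IHk p m v) => //; move: spv; rewrite binary_formS // mulrA.
    have hpv : v * binary_form p k x y \is (m + k).-homog.
      apply: dhomogM hv _; apply: rpred_sum => i _; apply: rpredZ.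
      have le_ik : (i <= k)%N by rewrite -ltnS.
      by have := dhomogM (dhomogMn i hy) (dhomogMn (k - i) hx); rewrite !mul1n subnKC.
    by apply: injx hpv; lia.
  have [c /factor_theorem[q def_p]] : exists c, root p c.
    by apply/closed_rootP; rewrite neq_ltn (leq_trans _ sz_p') ?orbT.
  have sz_q : (size q <= k.+1)%N.
    have [-> | nz_q] := eqVneq q 0; first by rewrite size_poly0.
    by move: sz_p; rewrite def_p size_Mmonic ?monicXsubC // size_XsubC addn2.
  have [svc | s'vc] := pselect (in_ideal s (v * (y - c *: x))).
    by exists c, m, v.
  apply: (IHk q (m + 1)%N (v * (y - c *: x))) => //; first lia.
  - exact: dhomogM.
  - by apply: contra nz_p => /eqP q0; rewrite def_p q0 mul0r.
  by rewrite mulrAC -mulrA -binary_formM // -def_p.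
have [p [nz_p sz_p spu]] : exists p : {poly K}, [/\ p != 0,
    (size p <= (hilbert s m1).+1)%N & in_ideal s (u * binary_form p (hilbert s m1) x y)].
  set e := hilbert s m1; pose v i := u * (y ^+ i * x ^+ (e - i)).
  have le_e : (hilbert s (m1 + e) <= e)%N by rewrite stable.
  have [|p [nz_p sz_p sp]] := @dependent_mod _ _ s (m1 + e) e v _ le_e.
    move=> i le_ie; apply: dhomogM hu _.
    by have := dhomogM (dhomogMn i hy) (dhomogMn (e - i) hx); rewrite !mul1n subnKC.
  exists p; split=> //; rewrite mulr_sumr.
  by under eq_bigr => i _ do rewrite -scalerAr.
have [c [m [v [le_m hv s'v svc]]]] := eigen _ _ _ _ (leqnn _) hu s'u nz_p sz_p spu.
have [m2 sc0] := artinian_hilbert (arty c).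
have hvx j : v * x ^+ j \is (m + j).-homog.
  by apply: dhomogM hv _; rewrite -[X in X.-homog]mul1n dhomogMn.
have {s'v} s'vx j : ~ in_ideal s (v * x ^+ j).
  elim: j => [|j IHj]; first by rewrite mulr1.
  by rewrite exprSr mulrA => /injx svx; apply/IHj/svx/hvx; lia.
case: (s'vx m2); apply: inj_at (hlin c) _ _ _ (hvx m2) _; first lia.
  by apply: sc0; lia.
by rewrite mulrAC; apply: in_idealMr.
Qed.

Lemma homog_congr_meval s z (v : 'I_n.+1 -> K) f d :
  (forall i, in_ideal s ('X_i - v i *: z)) -> f \is d.-homog ->
  in_ideal s (f - f.@[v] *: z ^+ d).
Proof.
move=> sX hf; rewrite {1}[f]mpolyE mevalE scaler_suml -sumrB big_seq.
apply: in_ideal_sum => a /(dhomog_mf hf) /= deg_a.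
rewrite -scalerA -scalerBr; apply: in_idealZ.
rewrite mpolyXE_id -deg_a mdegE -prodrXr -scaler_prod.
elim/big_ind2: _ => [|p p' q q' sp sq|i _].
- by rewrite subrr; apply: in_ideal0.
- exact: in_ideal_eqvM.
by rewrite -exprZn; apply: in_ideal_expB.
Qed.

(** By [artinian_pencil], if [s] were not Artinian one could enlarge it by linear forms,
    keeping it so, until all variables are multiples [v i z] of one linear form [z]
    modulo [s]. Then [y(v) z^d] is in the ideal for every [y] of degree [d] in [g], and
    [v] would be a nonzero common zero. *)
Theorem projective_nullstellensatz g : forms g ->
  (forall v : 'I_n.+1 -> K, (forall y, y \in g -> y.@[v] = 0) -> forall i, v i = 0) ->
  artinian g.
Proof.
move=> hg g0; suff main t s : forms s -> {subset g <= s} ->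
    (forall z, z \in t -> z \is 1.-homog) -> (forall i, in_ideal (s ++ t) 'X_i) -> artinian s.
  apply: (main (first_vars n K n.+1)) => // [z|i]; first exact: first_vars_homog.
  by apply/in_ideal_catr/in_ideal_mem/mem_first_vars.
have [r] := ubnP (size t).
elim: r t s => // r IHr [|z [|z2 t]] s le_r hs gs ht sX.
- by move=> i; exists 1%N; rewrite expr1; have := sX i; rewrite cats0.
- have hilbert_int : z \is 1.-homog by apply: ht; rewrite mem_head.
  have /choice[v sXv] i : exists c : K, in_ideal s ('X_i - c *: z).
    have := in_ideal_rcons_homog (m := 1) (p := 'X_i) hs hilbert_int; rewrite cats1 in sX.
    case=> // [|q /dhomogP hq sq]; first by rewrite dhomogX /= mdeg1.
    exists q@_0%MM; rewrite -mul_mpolyC; suff -> : (q@_0%MM)%:MP = q by [].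
    apply/esym/mpolyP=> a; rewrite mcoeffC; have [-> | a0] := eqVneq a 0%MM.
      by rewrite mulr1.
    rewrite mulr0; apply: memN_msupp_eq0; apply: contra a0 => /hq /=.
    by rewrite -mdeg_eq0 => ->.
  have [all0 | ] := pselect (forall y, y \in g -> y.@[v] = 0).
    move=> i; exists 1%N; rewrite expr1; have := sXv i.
    by rewrite (g0 v all0) scale0r subr0.
  move=> /existsNP[y /not_implyP[yg /eqP yv]]; have [d _ hy] := hg y yg.
  have szd : in_ideal s (z ^+ d).
    rewrite -[z ^+ d]scale1r -(mulVf yv) -scalerA; apply: in_idealZ.
    apply: in_ideal_eqv (in_idealBC (homog_congr_meval sXv hy)) _.
    exact/in_ideal_mem/gs.
  move=> i; exists d; apply: in_ideal_eqv (in_ideal_expB d (sXv i)) _.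
  by rewrite exprZn; apply: in_idealZ.
have hilbert_int : z \is 1.-homog by apply: ht; rewrite mem_head.
have hz2 : z2 \is 1.-homog by apply: ht; rewrite !inE eqxx orbT.
have mem x (l : seq {mpoly K[n.+1]}) : x \in l -> in_ideal l x by apply: in_ideal_mem.
apply: (artinian_pencil hs hilbert_int hz2) => [|c].
  apply: (IHr (z2 :: t)) => //; first exact: forms_rcons (ltn0Sn 0) hilbert_int hs.
  - by move=> y /gs ys; rewrite mem_rcons inE ys orbT.
  - by move=> y yt; apply: ht; rewrite inE yt orbT.
  by move=> i; rewrite cat_rcons.
apply: (IHr (z :: t)) => //.
- by apply: forms_rcons (ltn0Sn 0) _ hs; rewrite rpredB ?rpredZ.
- by move=> y /gs ys; rewrite mem_rcons inE ys orbT.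
- by move=> y; rewrite inE => /predU1P[-> // | yt]; apply: ht; rewrite !inE yt !orbT.
move=> i; apply: in_ideal_trans (sX i) => y; rewrite mem_cat !inE cat_rcons.
case/or4P=> [ys | /eqP-> | /eqP-> | yt].
- by apply: mem; rewrite mem_cat ys.
- by apply: mem; rewrite mem_cat !inE eqxx !orbT.
- rewrite -[X in in_ideal _ X](subrK (c *: z)).
  apply: in_idealD; last apply: in_idealZ;
    by apply: mem; rewrite mem_cat !inE eqxx ?orbT.
by apply: mem; rewrite mem_cat !inE yt !orbT.
Qed.

Lemma mderiv_homog d (F : {mpoly K[n.+1]}) i :
  F \is d.+1.-homog -> F^`M(i) \is d.-homog.
Proof.
move=> hF; apply/dhomogP => a; rewrite mcoeff_msupp mcoeff_deriv => Fa.
have : F@_(a + U_(i)) != 0 by apply: contraNneq Fa => ->; rewrite mul0rn.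
by rewrite -mcoeff_msupp => /(dhomog_mf hF) /=; rewrite mdegD mdeg1 addn1 => -[].
Qed.

Lemma smooth_artinian d (F : {mpoly K[n.+1]}) : (0 < d)%N -> F \is d.+1.-homog ->
  smooth_form F -> artinian [tuple F^`M(i) | i < n.+1].
Proof.
move=> d_gt0 hF smF; apply: projective_nullstellensatz => [y|v v0 i].
  by case/mapP=> i _ ->; exists d => //; apply: mderiv_homog.
by apply: smF => j; apply/v0/mapP; exists j; rewrite ?mem_enum.
Qed.

End Nullstellensatz.

(** * Linear substitutions *)

(** Every monomial is reached by successive multiplications by variables. *)
Lemma mpoly_indMX n (R : comNzRingType) (P : {mpoly R[n]} -> Prop) : P 1 ->
  (forall i p, P p -> P ('X_i * p)) -> (forall c p, P p -> P (c *: p)) ->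
  (forall p q, P p -> P q -> P (p + q)) -> forall p, P p.
Proof.
move=> P1 PM PZ PD p; rewrite [p]mpolyE.
elim/big_ind: _ => // [|a _]; first by rewrite -(scale0r 1); apply: PZ.
apply: PZ; have [k] := ubnP (mdeg a); elim: k a => // k IHk a le_k.
have [-> | a0] := eqVneq a 0%MM; first by rewrite mpolyX0.
have [i ai] : exists i, a i != 0%N.
  apply: contraPP a0 => no_i; apply/negP; rewrite negbK; apply/eqP/mnmP => i.
  by rewrite mnm0E; apply/eqP/negPn/negP=> ai; apply: no_i; exists i.
rewrite -lep1mP in ai; rewrite -(submK ai) addmC mpolyXD; apply/PM/IHk.
by move: le_k; rewrite -{1}(submK ai) mdegD mdeg1 addn1.
Qed.

(** With this convention, composing substitutions is multiplying matrices in the same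
    order, and the dual action of [A] is the substitution of its inverse. *)
Definition lin_subst n (R : comNzRingType) (A : 'M[R]_n) : n.-tuple {mpoly R[n]} :=
  [tuple \sum_i A j i *: 'X_i | j < n].

Section LinSubst.
Variables (n : nat) (R : comNzRingType).
Implicit Types (A B : 'M[R]_n) (p : {mpoly R[n]}).

Lemma lin_substX A j : 'X_j \mPo lin_subst A = \sum_i A j i *: 'X_i.
Proof. by rewrite comp_mpolyXU -tnth_nth tnth_mktuple. Qed.

Lemma lin_substM A p q :
  (p * q) \mPo lin_subst A = (p \mPo lin_subst A) * (q \mPo lin_subst A).
Proof. exact: rmorphM. Qed.

Lemma lin_subst_comp A B p :
  (p \mPo lin_subst A) \mPo lin_subst B = p \mPo lin_subst (A *m B).
Proof.
elim/mpoly_indMX: p => [|j p IHp|c p IHp|p q IHp IHq].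
- by rewrite !comp_mpoly1.
- rewrite !lin_substM IHp !lin_substX raddf_sum /=; congr (_ * _).
  under eq_bigr => i _ do rewrite comp_mpolyZ lin_substX scaler_sumr.
  rewrite exchange_big /=; apply: eq_bigr => k _.
  by rewrite mxE scaler_suml; apply: eq_bigr => i _; rewrite scalerA.
- by rewrite !comp_mpolyZ IHp.
by rewrite !comp_mpolyD IHp IHq.
Qed.

Lemma lin_subst1 p : p \mPo lin_subst 1%:M = p.
Proof.
rewrite -[RHS]comp_mpoly_id; congr (_ \mPo _); apply: eq_from_tnth => j.
rewrite !tnth_mktuple (bigD1 j) //= !mxE eqxx scale1r big1 ?addr0 // => i ne_ij.
by rewrite mxE eq_sym (negbTE ne_ij) scale0r.
Qed.

Lemma lin_substK A B : A *m B = 1%:M ->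
  cancel (comp_mpoly (lin_subst A)) (comp_mpoly (lin_subst B)).
Proof. by move=> AB p; rewrite lin_subst_comp AB lin_subst1. Qed.

Lemma lin_subst_homog A d p : p \is d.-homog -> p \mPo lin_subst A \is d.-homog.
Proof.
move=> /dhomogP hp; rewrite comp_mpolyEX big_seq; apply: rpred_sum => a /hp <-.
apply: rpredZ; rewrite comp_mpolyX /= mdegE.
elim/big_rec2: _ => [|i q k _ hq]; first exact: dhomog1.
apply: dhomogM hq; rewrite -[X in X.-homog]mul1n; apply: dhomogMn.
by rewrite tnth_mktuple; apply: rpred_sum => j _; apply: rpredZ; rewrite dhomogX /= mdeg1.
Qed.

Lemma mcoeff_diag_subst (t : 'rV[R]_n) p a :
  (p \mPo lin_subst (diag_mx t))@_a = p@_a * \prod_i t 0 i ^+ a i.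
Proof.
rewrite {1}[p]mpolyE [_ \mPo _]raddf_sum raddf_sum /=.
have subX b : 'X_[R, b] \mPo lin_subst (diag_mx t) = (\prod_i t 0 i ^+ b i) *: 'X_[b].
  rewrite comp_mpolyX mpolyXE_id -scaler_prod; apply: eq_bigr => i _.
  rewrite tnth_mktuple -exprZn (bigD1 i) //= mxE eqxx mulr1n big1 ?addr0 // => j ne_ji.
  by rewrite mxE eq_sym (negbTE ne_ji) mulr0n scale0r.
under eq_bigr => b _ do rewrite comp_mpolyZ subX !mcoeffZ mcoeffX.
have [pa | p'a] := boolP (a \in msupp p); last first.
  rewrite (memN_msupp_eq0 p'a) mul0r big_seq big1 // => b pb.
  by case: eqP => [def_b | _]; [rewrite -def_b pb in p'a | rewrite !mulr0].
rewrite (bigD1_seq a) ?msupp_uniq //= eqxx mulr1 [X in _ + X]big1 ?addr0 // => b /negbTE->.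
by rewrite !mulr0.
Qed.

End LinSubst.

Lemma map_lin_subst n (R S : comNzRingType) (f : {rmorphism R -> S}) (A : 'M[R]_n) p :
  map_mpoly f (p \mPo lin_subst A) = map_mpoly f p \mPo lin_subst (map_mx f A).
Proof.
elim/mpoly_indMX: p => [|j p IHp|c p IHp|p q IHp IHq].
- by rewrite !rmorph1.
- rewrite lin_substM !rmorphM /= IHp; congr (_ * _).
  rewrite map_mpolyX !lin_substX raddf_sum; apply: eq_bigr => i _ /=.
  by rewrite map_mpolyZ map_mpolyX mxE.
- by rewrite comp_mpolyZ !map_mpolyZ IHp comp_mpolyZ.
by rewrite comp_mpolyD !rmorphD /= IHp IHq.
Qed.

(** * The polar pairing *)

Section Polar.
Variables (n : nat) (K : fieldType).
Implicit Types (F p q : {mpoly K[n]}) (a b : 'X_{1..n}).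

Definition mfact a := (\prod_i (a i)`!)%N.

Lemma polarE F p : polar F p = \sum_(a <- msupp F) F@_a * (p@_a *+ mfact a).
Proof.
rewrite /polar raddf_sum; apply: eq_bigr => a _ /=.
rewrite mcoeffZ mcoeff_mderivm addm0; congr (_ * (_ *+ _)).
by apply: eq_bigr => i _; rewrite ffactnn.
Qed.

Lemma polarwE w F p : (msize F <= w)%N ->
  polar F p = \sum_(a : 'X_{1..n < w}) F@_a * (p@_a *+ mfact a).
Proof.
move=> le_w; pose I : subFinType _ := 'X_{1..n < w}.
rewrite polarE (ssrcomplements.big_mksub I) //=; first last.
- by move=> a /msize_mdeg_lt /leq_trans; apply.
- by rewrite msupp_uniq.
by rewrite big_rmcond //= => a /memN_msupp_eq0 ->; rewrite mul0r.
Qed.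

Lemma polarDl F G p : polar (F + G) p = polar F p + polar G p.
Proof.
pose w := maxn (msize F) (msize G).
rewrite (polarwE (w := w)) ?msizeD_le // (polarwE (w := w)) ?leq_maxl //.
rewrite (polarwE (F := G) (w := w)) ?leq_maxr // -big_split /=.
by apply: eq_bigr => a _; rewrite mcoeffD mulrDl.
Qed.

Lemma polarZl c F p : polar (c *: F) p = c * polar F p.
Proof.
rewrite (polarwE (w := msize F)) ?msizeZ_le // (polarwE (w := msize F)) //.
by rewrite mulr_sumr; apply: eq_bigr => a _; rewrite mcoeffZ mulrA.
Qed.

Lemma polarDr F p q : polar F (p + q) = polar F p + polar F q.
Proof.
rewrite !polarE -big_split /=; apply: eq_bigr => a _.
by rewrite mcoeffD mulrnDl mulrDr.
Qed.

Lemma polarZr c F p : polar F (c *: p) = c * polar F p.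
Proof.
rewrite !polarE mulr_sumr; apply: eq_bigr => a _.
by rewrite mcoeffZ -mulrnAr mulrCA.
Qed.

Lemma polarBl F G p : polar (F - G) p = polar F p - polar G p.
Proof. by rewrite -scaleN1r polarDl polarZl mulN1r. Qed.

Lemma polarBr F p q : polar F (p - q) = polar F p - polar F q.
Proof. by rewrite -scaleN1r polarDr polarZr mulN1r. Qed.

Lemma polar0l p : polar 0 p = 0.
Proof. by rewrite -(scale0r 0) polarZl mul0r. Qed.

Lemma polar0r F : polar F 0 = 0.
Proof. by rewrite -(scale0r 0) polarZr mul0r. Qed.

Lemma polar_suml (I : Type) (r : seq I) (P : pred I) (G : I -> {mpoly K[n]}) p :
  polar (\sum_(i <- r | P i) G i) p = \sum_(i <- r | P i) polar (G i) p.
Proof.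
elim/big_rec2: _ => [|i c F _ <-]; first exact: polar0l.
exact: polarDl.
Qed.

Lemma polar_sumr (I : Type) (r : seq I) (P : pred I) F (G : I -> {mpoly K[n]}) :
  polar F (\sum_(i <- r | P i) G i) = \sum_(i <- r | P i) polar F (G i).
Proof.
elim/big_rec2: _ => [|i c p _ <-]; first exact: polar0r.
exact: polarDr.
Qed.

Lemma polarXl a p : polar 'X_[a] p = p@_a *+ mfact a.
Proof. by rewrite polarE msuppX big_seq1 mcoeffX eqxx mul1r. Qed.

Lemma polarXr a F : polar F 'X_[a] = F@_a *+ mfact a.
Proof.
rewrite {1}[F]mpolyE polar_suml.
have [Fa | F'a] := boolP (a \in msupp F).
  rewrite (bigD1_seq a) ?msupp_uniq //= big1 ?addr0 => [|b ne_ba].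
    by rewrite polarZl polarXl mcoeffX eqxx mulrnAr mulr1.
  by rewrite polarZl polarXl mcoeffX eq_sym (negbTE ne_ba) mul0rn mulr0.
rewrite (memN_msupp_eq0 F'a) mul0rn big_seq big1 // => b Fb.
rewrite polarZl polarXl mcoeffX; case: eqP => [def_a | _]; last by rewrite mul0rn mulr0.
by rewrite def_a Fb in F'a.
Qed.

Lemma polarMX j F p : polar ('X_j * F) p = polar F p^`M(j).
Proof.
rewrite {1}[F]mpolyE mulr_sumr polar_suml [in RHS]polarE; apply: eq_bigr => a _.
rewrite -scalerAr -mpolyXD polarZl polarXl mcoeff_mderiv addmC -mulrnA.
congr (_ * (_ *+ _)); rewrite /mfact (bigD1 j) //= [in RHS](bigD1 j) //=.
rewrite mnmDE mnm1E eqxx addn1 factS mulnA; congr (_ * _)%N.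
by apply: eq_bigr => i ne_ij; rewrite mnmDE mnm1E eq_sym (negbTE ne_ij) addn0.
Qed.

Lemma mderivXU i j : 'X_i^`M(j) = (i == j)%:R%:MP :> {mpoly K[n]}.
Proof.
rewrite mderivX mnm1E; case: eqP => [-> | _]; last by rewrite scale0r mpolyC0.
rewrite scale1r [RHS]mpolyC1 -mpolyX0; congr 'X_[_].
by apply/mnmP => k; rewrite mnmBE subnn mnm0E.
Qed.

Lemma mderiv_lin_subst (A : 'M[K]_n) j p :
  (p \mPo lin_subst A)^`M(j) = \sum_i A i j *: (p^`M(i) \mPo lin_subst A).
Proof.
elim/mpoly_indMX: p.
- rewrite comp_mpoly1 -mpolyC1 mderivC big1 // => i _.
  by rewrite mderivC comp_mpoly0 scaler0.
- move=> k p IHp; rewrite lin_substM lin_substX.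
  rewrite mderivM IHp [X in _ + X]mulr_sumr raddf_sum /=.
  have -> : \sum_i (A k i *: 'X_i)^`M(j) = (A k j)%:MP :> {mpoly K[n]}.
    rewrite (bigD1 j) //= big1 => [|i ne_ij].
      by rewrite mderivZ mderivXU eqxx -mul_mpolyC mulr1 addr0.
    by rewrite mderivZ mderivXU (negbTE ne_ij) mpolyC0 scaler0.
  have -> : (A k j)%:MP * (p \mPo lin_subst A) =
      \sum_i A i j *: ((k == i)%:R *: (p \mPo lin_subst A)).
    rewrite (bigD1 k) //= eqxx scale1r mul_mpolyC big1 ?addr0 // => i ne_ik.
    by rewrite eq_sym (negbTE ne_ik) scale0r scaler0.
  rewrite -big_split /=; apply: eq_bigr => i _.
  rewrite mderivM mderivXU comp_mpolyD !rmorphM /= comp_mpolyC lin_substX.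
  by rewrite mul_mpolyC -scalerAr scalerDr.
- by move=> c p IHp; rewrite comp_mpolyZ !mderivZ IHp scaler_sumr;
    apply: eq_bigr => i _; rewrite mderivZ comp_mpolyZ !scalerA mulrC.
move=> p q IHp IHq; rewrite comp_mpolyD mderivD IHp IHq -big_split /=.
by apply: eq_bigr => i _; rewrite mderivD comp_mpolyD scalerDr.
Qed.

(** Multiplication by [x_j] is adjoint to the derivation along [x_j] ([polarMX]), so the
    substitution on the left is matched with the chain rule on the right. *)
Lemma polar_lin_subst (A : 'M[K]_n) F p :
  polar (F \mPo lin_subst A) p = polar F (p \mPo lin_subst A^T).
Proof.
elim/mpoly_indMX: F p => [p | j F IHF p | c F IHF p | F G IHF IHG p].
- rewrite comp_mpoly1 -mpolyX0 !polarXl; congr (_ *+ _).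
  elim/mpoly_indMX: p => [|i p IHp|c p IHp|p q IHp IHq].
  + by rewrite comp_mpoly1.
  + rewrite lin_substM lin_substX.
    rewrite !(rmorphM (mcoeff 0%MM)) /= -IHp; congr (_ * _).
    rewrite raddf_sum /= big1 => [|k _]; last first.
      by rewrite mcoeffZ mcoeffX mnm1_eq0 mulr0.
    by rewrite mcoeffX mnm1_eq0.
  + by rewrite comp_mpolyZ !mcoeffZ IHp.
  by rewrite comp_mpolyD !mcoeffD IHp IHq.
- rewrite lin_substM lin_substX mulr_suml polar_suml.
  rewrite polarMX mderiv_lin_subst polar_sumr; apply: eq_bigr => i _.
  by rewrite -scalerAl polarZl polarMX IHF polarZr mxE.
- by rewrite comp_mpolyZ !polarZl IHF.
by rewrite comp_mpolyD !polarDl IHF IHG.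
Qed.

End Polar.

(** * Apolarity in the socle degree *)

Section Apolar.
Variables (n : nat) (K : numFieldType).
Implicit Types (F p q : {mpoly K[n.+1]}) (a b : 'X_{1..n.+1}).

Lemma mfact_neq0 a : (mfact a)%:R != 0 :> K.
Proof. by rewrite pnatr_eq0 -lt0n prodn_gt0 // => i; apply: fact_gt0. Qed.

Lemma polarX_eq0 F a : polar F 'X_[a] = 0 -> F@_a = 0.
Proof.
rewrite polarXr -mulr_natr => /eqP.
by rewrite mulf_eq0 (negbTE (mfact_neq0 a)) orbF => /eqP.
Qed.

Lemma polar_pihomog m F p : F \is m.-homog -> polar F (pihomog mdeg m p) = polar F p.
Proof.
move=> hF; rewrite [p in RHS]mpolyE /pihomog big_mkcond !polar_sumr.
apply: eq_bigr => a _; rewrite polarZr; case: eqP => [_ | /eqP ne_am].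
  by rewrite polarZr.
by rewrite polar0r polarXr (dhomog_nemf_coeff hF ne_am) mul0rn mulr0.
Qed.

Definition head_degree a j := (\sum_(i < n.+1 | i < j) a i)%N.

Lemma head_degreeD a b j : head_degree (a + b)%MM j = (head_degree a j + head_degree b j)%N.
Proof. by rewrite /head_degree -big_split; apply: eq_bigr => i _; rewrite mnmDE. Qed.

(** The factor of a monomial in the first [j] variables. *)
Definition head_part j a := [multinom if (i < j)%N then a i else 0%N | i < n.+1].

Lemma head_degree_part i j a : (i <= j)%N -> head_degree (head_part j a) i = head_degree a i.
Proof.
move=> le_ij; apply: eq_bigr => k lt_ki.
by rewrite mnmE (leq_trans lt_ki le_ij).
Qed.

Lemma head_part_le j a : (head_part j a <= a)%MM.
Proof. by apply/mnm_lepP => i; rewrite mnmE; case: ifP. Qed.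

Lemma mdeg_head_part j a : mdeg (head_part j a) = head_degree a j.
Proof.
rewrite mdegE /head_degree [RHS]big_mkcond; apply: eq_bigr => i _.
by rewrite mnmE.
Qed.

(** Let a monomial of the degree of [F] have [head_degree] less than [j * d.-1] in the
    first [j] variables. Its factor in the other variables has degree more than
    [(n.+1 - j) * d.-1], so by [in_ideal_large_degree] it is congruent modulo [(g)] to a
    combination of multiples of the first [j] variables. This raises the head degree,
    and does not lower the heads shorter than [j]. Treating every [j] in increasing
    order, all monomials become combinations of monomials with all heads large. If [F]
    had none of these, it would be orthogonal to all monomials. *)
Theorem exists_heavy_monomial d g F : (0 < d)%N -> size g = n.+1 ->
  (forall y, y \in g -> y \is d.-homog) -> artinian g ->
  F != 0 -> F \is (n.+1 * d.-1).-homog -> (forall p, in_ideal g p -> polar F p = 0) ->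
  exists2 a, F@_a != 0 & forall j, (j <= n.+1)%N -> (j * d.-1 <= head_degree a j)%N.
Proof.
move=> d_gt0 sz_g hg artg nzF hF Fg; apply: contrapT => no_a.
have deg_a a : mdeg a != (n.+1 * d.-1)%N -> polar F 'X_[a] = 0.
  by move=> ne_a; rewrite polarXr (dhomog_nemf_coeff hF ne_a) mul0rn.
(* [n.+2 - j] is the length of the first head that may still be too small. *)
suff main j : (j <= n.+2)%N -> forall a,
    (forall i, (i < n.+2 - j)%N -> (i * d.-1 <= head_degree a i)%N) -> polar F 'X_[a] = 0.
  case/eqP: nzF; apply/mpolyP => a; rewrite mcoeff0; apply: polarX_eq0.
  by apply: (main n.+2) => // i; rewrite subnn.
elim: j => [|j IHj] le_jn a heavy.
  rewrite polarXr; have [-> | Fa] := eqVneq F@_a 0; first by rewrite mul0rn.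
  by case: no_a; exists a => // i; rewrite -ltnS -[n.+2]subn0 => /heavy.
set k := (n.+2 - j.+1)%N in heavy; have def_k : (n.+2 - j)%N = k.+1 by lia.
have {}IHj := IHj (ltnW le_jn); rewrite def_k in IHj.
have [e] := ubnP (n.+1 * d.-1 - head_degree a k); elim: e a heavy => // e IHe a heavy le_e.
have [deg_a' | /deg_a //] := eqVneq (mdeg a) (n.+1 * d.-1)%N.
have [heavy_k | light_k] := leqP (k * d.-1) (head_degree a k).
  by apply: IHj => i; rewrite ltnS leq_eqVlt => /predU1P[-> | /heavy].
have le_kn : (k <= n.+1)%N by lia.
pose a1 := head_part k a; pose a2 := (a - a1)%MM.
have def_a : a = (a1 + a2)%MM by rewrite addmC submK ?head_part_le.
have deg_a2 : ((n.+1 - k) * d.-1 < mdeg a2)%N.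
  have := mdegD a1 a2; rewrite -def_a mdeg_head_part deg_a' mulnBl.
  by have := leq_mul le_kn (leqnn d.-1); lia.
have := @in_ideal_large_degree _ _ d g d_gt0 sz_g hg artg (n.+1 - k) _ 'X_[a2]
  (leq_subr _ _) deg_a2.
rewrite subKn // dhomogX => /(_ (eqxx _)).
suff kill p : in_ideal (first_vars n K k ++ g) p -> polar F ('X_[a1] * p) = 0.
  by move/kill; rewrite -mpolyXD -def_a.
elim/in_ideal_ind => [|{}p q Fp Fq|q y].
- by rewrite mulr0 polar0r.
- by rewrite mulrDr polarDr Fp Fq addr0.
rewrite mem_cat => /orP[yX|yg]; last by apply/Fg/in_idealMl/in_idealMl/in_ideal_mem.
case/mapP: yX => i.
rewrite mem_iota /= add0n => lt_ik ->.
rewrite {1}[q]mpolyE mulr_suml mulr_sumr polar_sumr big1 // => b _.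
rewrite -scalerAl -scalerAr polarZr -!mpolyXD; apply/eqP.
rewrite mulf_eq0; apply/orP; right; apply/eqP; set a' := (_ + _)%MM.
have headE l : (l <= k)%N ->
    head_degree a' l = (head_degree a l + head_degree (b + U_(inord i))%MM l)%N.
  by move=> le_lk; rewrite {1}/a' head_degreeD head_degree_part.
apply: IHe => [l lt_lk|].
  by rewrite headE ?(ltnW lt_lk) // (leq_trans (heavy l lt_lk)) ?leq_addr.
have : (0 < head_degree U_(inord i) k)%N.
  by rewrite /head_degree (bigD1 (inord i)) ?inordK ?(leq_trans lt_ik) //= mnm1E eqxx.
rewrite headE // head_degreeD.
have := leq_mul le_kn (leqnn d.-1); lia.
Qed.

(** The ideal is the kernel of a linear form [lam] in this degree. Monomials are
    orthogonal for the polar pairing, with [x^a] of square norm [a!], so [lam] is the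
    pairing with the form whose coefficients are [lam (x^a) / a!]. *)
Theorem associated_form_exists d g : forms g -> hilbert g (n.+1 * d.-1) = 1%N ->
  exists A : proj (dhomog n.+1 K (n.+1 * d.-1)), is_associated_form d g A.
Proof.
set m := (n.+1 * d.-1)%N => hg hilb1.
have [p0 hp0 g'p0] : exists2 p0, p0 \is m.-homog & ~ in_ideal g p0.
  have /existsNP[p0 /not_implyP[hp0 gp0]] : ~ forall p, p \is m.-homog -> in_ideal g p.
    by move/hilbert_eq0; rewrite hilb1.
  by exists p0.
have /choice[lam lamP] p : exists c, p \is m.-homog -> in_ideal g (p - c *: p0).
  have [hp | ] := boolP (p \is m.-homog); last by exists 0.
  pose P0 := DHomog hp0; pose W := ideal_part g m.
  have : DHomog hp \in (W + <[P0]>)%VS.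
    suff -> : (W + <[P0]>)%VS = fullv by apply: memvf.
    have W'P0 : P0 \notin W by apply/negP => /ideal_partP.
    apply/eqP; rewrite eqEdim subvf /=.
    have lt_dim : (\dim W < \dim (W + <[P0]>))%N.
      rewrite ltn_neqAle dimvS ?addvSl // andbT (dimv_leqif_sup (addvSl _ _)).2.
      by apply: contra W'P0 => /subvP->; rewrite // memvE addvSr.
    by apply: leq_trans lt_dim; move: hilb1; rewrite /hilbert -/W; lia.
  case/memv_addP=> w /ideal_partP gw [_ /vlineP[c ->] /(congr1 val)/= ->].
  by exists c => _; rewrite addrK.
pose F0 : {mpoly K[n.+1]} :=
  \sum_(a : 'X_{1..n.+1 < m.+1} | mdeg a == m) (lam 'X_[a] / (mfact a)%:R) *: 'X_[a].
have hF0 : F0 \is m.-homog.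
  by apply: rpred_sum => a deg_a; apply: rpredZ; rewrite dhomogX.
have F0P p : p \is m.-homog -> in_ideal g (p - polar F0 p *: p0).
  move=> hp; have sz_p : (msize p <= m.+1)%N.
    rewrite msizeE; apply/bigmax_leqP_seq => a /(dhomog_mf hp) /= -> _; exact: leqnn.
  have -> : p - polar F0 p *: p0 = \sum_(a : 'X_{1..n.+1 < m.+1} | mdeg a == m)
      p@_a *: ('X_[a] - lam 'X_[a] *: p0).
    rewrite polar_suml scaler_suml; under [RHS]eq_bigr => a _ do rewrite scalerBr.
    rewrite sumrB -(pihomogwE _ _ sz_p) pihomog_dE //; congr (_ - _).
    apply: eq_bigr => a _; rewrite polarZl polarXl scalerA -(mulr_natr p@_a); congr (_ *: _).
    by rewrite mulrCA divfK ?mfact_neq0.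
  apply: in_ideal_sum => a deg_a; apply/in_idealZ/lamP; by rewrite dhomogX.
have F0g p : p \is m.-homog -> in_ideal g p -> polar F0 p = 0.
  move=> hp gp; apply/eqP; apply: contraPT g'p0 => nz.
  have := in_idealB gp (F0P p hp).
  rewrite subKr => /(in_idealZ (polar F0 p)^-1); rewrite scalerA mulVf // scale1r.
  by move=> gp0 /(_ gp0).
have nzF0 : DHomog hF0 != 0.
  apply: contraPneq g'p0 => /(congr1 val)/= F00 g'p0; apply: g'p0.
  by have := F0P p0 hp0; rewrite F00 polar0l scale0r subr0.
have dim1 : \dim <[DHomog hF0]>%VS == 1%N by rewrite dim_vline nzF0.
exists (Proj dim1) => F; split=> /= [/vlineP[c ->] p hp gp | Fg].
  by rewrite /= polarZl F0g ?mulr0.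
apply/vlineP; exists (polar F p0); apply/val_inj/mpolyP => a /=.
have [ha | ne_a] := eqVneq (mdeg a) m; last first.
  by rewrite mcoeffZ (dhomog_nemf_coeff (valP F) ne_a) (dhomog_nemf_coeff hF0 ne_a) mulr0.
apply/eqP; rewrite -subr_eq0 -mcoeffB; apply/eqP/polarX_eq0.
have hX : 'X_[K, a] \is m.-homog by rewrite dhomogX; apply/eqP.
have := Fg _ _ (F0P _ hX); rewrite rpredB ?rpredZ // => /(_ isT).
rewrite polarBr polarZr polarBl polarZl => /eqP.
by rewrite !subr_eq0 => /eqP->; rewrite mulrC subrr.
Qed.

End Apolar.

(** * Places *)

Section Places.
Variables (C : closedFieldType) (K : fieldType) (iota : {rmorphism C -> K}).
Implicit Types (G : set (K * C)) (x : K) (c : C).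

(** The graph of a ring morphism to [C], over [C], from a subring of [K] containing the
    constants. It is a subring of [K * C], which turns the extension of such morphisms
    into the inclusion of sets. *)
Record place_graph G : Prop := PlaceGraph {
  pg_const : forall c, G (iota c, c);
  pg_add : forall y z, G y -> G z -> G (y + z);
  pg_mul : forall y z, G y -> G z -> G (y * z);
  pg_fun : forall c, G (0, c) -> c = 0 }.

Section Closure.
Variables (G : set (K * C)) (pG : place_graph G).

Lemma pg0 : G 0. Proof. by have := pg_const pG 0; rewrite rmorph0. Qed.
Lemma pg1 : G 1. Proof. by have := pg_const pG 1; rewrite rmorph1. Qed.

Lemma pgN y : G y -> G (- y).
Proof.
move/(pg_mul pG (pg_const pG (-1))); rewrite rmorphN1.
by case: y => x c; congr G; congr pair; rewrite /= mulN1r.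
Qed.

Lemma pg_sum (I : Type) (r : seq I) (P : pred I) F :
  (forall i, P i -> G (F i)) -> G (\sum_(i <- r | P i) F i).
Proof. by move=> GF; elim/big_ind: _ => //; [apply: pg0 | apply: pg_add]. Qed.

(** The kernel of the morphism; it is the maximal ideal once [G] is maximal. *)
Definition in_max x := G (x, 0).

Lemma in_max0 : in_max 0. Proof. exact: pg0. Qed.

Lemma in_maxD x y : in_max x -> in_max y -> in_max (x + y).
Proof. by move=> Gx Gy; have := pg_add pG Gx Gy; rewrite /in_max -[0 in X in _ -> X]addr0. Qed.

Lemma in_maxMl x c y : G (x, c) -> in_max y -> in_max (x * y).
Proof. by move=> Gx Gy; have := pg_mul pG Gx Gy; rewrite /in_max -[0 in X in _ -> X](mulr0 c). Qed.

Lemma in_maxMM x y : in_max x -> in_max y -> in_max (x * y).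
Proof. exact: in_maxMl. Qed.

Lemma in_max1 : ~ in_max 1.
Proof.
move=> G10; have := pg_add pG pg1 (pgN G10).
have -> : (1 : K * C) + - (1, 0) = (0, 1) by congr pair; rewrite /= ?subrr ?subr0.
by move/(pg_fun pG)/eqP; rewrite oner_eq0.
Qed.

(** That [1] is of this form is the obstruction to giving a value to [x]. *)
Definition max_span x k z :=
  exists2 m : nat -> K, (forall i, in_max (m i)) & z = \sum_(i < k.+1) m i * x ^+ i.

Lemma max_spanD x k y z : max_span x k y -> max_span x k z -> max_span x k (y + z).
Proof.
case=> m Gm -> [m' Gm' ->]; exists (fun i => m i + m' i) => [i|].
  exact: in_maxD.
by rewrite -big_split; apply: eq_bigr => i _; rewrite mulrDl.
Qed.

Lemma max_span_mon x k i m : (i <= k)%N -> in_max m -> max_span x k (m * x ^+ i).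
Proof.
move=> le_ik Gm; exists (fun j => if j == i then m else 0) => [j|].
  by case: eqP => // _; apply: in_max0.
have lt_ik : (i < k.+1)%N by [].
rewrite (bigD1 (Ordinal lt_ik)) //= eqxx big1 ?addr0 // => j.
by rewrite -val_eqE /= => /negbTE->; rewrite mul0r.
Qed.

Lemma max_span_sum x k (I : Type) (r : seq I) (P : pred I) F :
  (forall i, P i -> max_span x k (F i)) -> max_span x k (\sum_(i <- r | P i) F i).
Proof.
move=> GF; elim/big_ind: _ => //; last exact: max_spanD.
by have := max_span_mon x (leq0n k) in_max0; rewrite mul0r.
Qed.

(** Of the two relations, the shorter one serves to eliminate the leading term of the
    longer one, up to the factor [u], which is congruent to [1]. *)
Lemma no_double_relation k x N M : (N + M <= k)%N -> x != 0 ->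
  max_span x N 1 -> max_span x^-1 M 1 -> False.
Proof.
elim: k x N M => [|k IHk] x N M.
  rewrite leqn0 addn_eq0 => /andP[/eqP-> _] _ [m Gm].
  by rewrite big_ord1 mulr1 => one _; apply: in_max1; rewrite one.
wlog le_MN : x N M / (M <= N)%N => [Hwlog|].
  have [le_MN | /ltnW le_NM] := leqP M N; first exact: Hwlog.
  move=> le_k nz_x xN xM; apply: (Hwlog (x^-1) M N) => //; rewrite ?invrK ?invr_eq0 //.
  by rewrite addnC.
case: N le_MN => [|N] le_MN le_k nz_x.
  move=> [m Gm]; rewrite big_ord1 mulr1 => one _.
  by apply: in_max1; rewrite one.
move=> [m Gm def_1] xM; have [m' Gm' def_1'] := xM.
apply: (IHk x N M) => //; rewrite -[X in max_span _ _ X](subrK (m' 0%N)).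
apply: max_spanD; last by have := max_span_mon x (leq0n N) (Gm' 0%N); rewrite mulr1.
pose u := 1 - m' 0%N; have Gu : G (u, 1).
  have := pg_add pG pg1 (pgN (Gm' 0%N)).
  by congr G; congr pair; rewrite /= ?subr0.
have def_u : u = \sum_(j < M) m' j.+1 * x^-1 ^+ j.+1.
  by rewrite /u {1}def_1' big_ord_recl mulr1 addrC addrA addNr add0r.
rewrite -/u -[u]mulr1 def_1 mulr_sumr big_ord_recr /=.
apply: max_spanD.
  apply: max_span_sum => i _; rewrite mulrA; apply: max_span_mon; first by rewrite -ltnS.
  exact: in_maxMl Gu (Gm i).
rewrite def_u mulr_suml; apply: max_span_sum => j _.
have lt_jM := leq_trans (ltn_ord j) le_MN.
have -> : m' j.+1 * x^-1 ^+ j.+1 * (m N.+1 * x ^+ N.+1) = m' j.+1 * m N.+1 * x ^+ (N - j).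
  have := exprD x j.+1 (N.+1 - j.+1); rewrite subnKC // subSS mulrACA => ->.
  congr (_ * _); by rewrite mulrA -exprMn mulVf // expr1n mul1r.
by apply: max_span_mon; [rewrite leq_subr | apply: in_maxMM].
Qed.

(** The valuation property: if neither [x] nor its inverse has a value, both are
    obstructed, which [no_double_relation] excludes. *)
Lemma maximal_dichotomy :
  (forall x, (forall k, ~ max_span x k 1) -> exists c, G (x, c)) ->
  forall x, (exists c, G (x, c)) \/ exists c, G (x^-1, c).
Proof.
move=> ext x; apply: contrapT => /not_orP[no_x no_Vx].
have [x0 | nz_x] := eqVneq x 0; first by apply: no_x; exists 0; rewrite x0; apply: pg0.
have [N xN] : exists N, max_span x N 1.
  by apply: contrapT => xN; apply/no_x/ext => k xk; apply: xN; exists k.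
have [M xM] : exists M, max_span x^-1 M 1.
  by apply: contrapT => xM; apply/no_Vx/ext => k xk; apply: xM; exists k.
exact: no_double_relation (leqnn _) nz_x xN xM.
Qed.

(** The algebraic relations of [x] over the subring, with their coefficients replaced by
    their values in [C], form an ideal of [C[X]]. It is proper because there is no
    relation with value [1], so it has a root [c], and [x] can be sent to [c]. *)
Lemma place_adjoin x : (forall k, ~ max_span x k 1) ->
  exists c (G' : set (K * C)), [/\ place_graph G', (G `<=` G')%classic & G' (x, c)].
Proof.
move=> no_rel.
pose coefsG (P : {poly K * C}) := forall i, G P`_i.
have GC c : coefsG (iota c, c)%:P.
  by move=> i; rewrite coefC; case: ifP => _; [apply: pg_const | apply: pg0].
have GA P Q : coefsG P -> coefsG Q -> coefsG (P + Q).
  by move=> GP GQ i; rewrite coefD; apply: pg_add.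
have GM P Q : coefsG P -> coefsG Q -> coefsG (P * Q).
  by move=> GP GQ i; rewrite coefM; apply: pg_sum => j _; apply: pg_mul.
pose A (q : {poly C}) := exists P,
  [/\ coefsG P, (map_poly fst P).[x] = 0 & map_poly snd P = q].
have lift (r : {poly C}) : exists2 P, coefsG P & map_poly snd P = r.
  exists (\poly_(i < size r) (iota r`_i, r`_i)).
    by move=> i; rewrite coef_poly; case: ifP => _; [apply: pg_const | apply: pg0].
  apply/polyP=> i; rewrite coef_map coef_poly; case: ltnP => //= le_r.
  by rewrite nth_default.
have AM r q : A q -> A (r * q).
  case=> P [GP Px def_q]; have [Q GQ def_r] := lift r; exists (Q * P); split.
  - exact: GM.
  - by rewrite rmorphM /= hornerM Px mulr0.
  by rewrite rmorphM /= def_q def_r.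
have AA p q : A p -> A q -> A (p + q).
  case=> P [GP Px <-] [Q [GQ Qx <-]]; exists (P + Q); split; first exact: GA.
    by rewrite rmorphD /= hornerD Px Qx addr0.
  by rewrite rmorphD.
have A1 : ~ A 1.
  case=> P [GP Px def_1]; apply: (no_rel (size P)).
  exists (fun i => (i == 0%N)%:R - (P`_i).1).
    move=> i; have := pg_add pG (pg_const pG (i == 0%N)%:R) (pgN (GP i)).
    have := congr1 (fun p : {poly C} => p`_i) def_1; rewrite coef_map coef1 /= => Pi.
    by rewrite /in_max; congr G; congr pair; rewrite /= ?rmorph_nat // Pi subrr.
  have Px0 : \sum_(i < (size P).+1) (P`_i).1 * x ^+ i = 0.
    rewrite -[RHS]Px (@horner_coef_wide _ (size P).+1).
      by apply: eq_bigr => i _; rewrite coef_map.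
    exact: leq_trans (size_poly _ _) (leqnSn _).
  under eq_bigr => i _ do rewrite mulrBl.
  rewrite sumrB Px0 subr0 big_ord_recl /= mul1r expr0 big1 ?addr0 // => i _.
  by rewrite mul0r.
have [c Ac] : exists c, forall q, A q -> q.[c] = 0.
  have [A0 | ] := pselect (forall q, A q -> q = 0).
    by exists 0 => q /A0->; rewrite horner0.
  move=> /existsNP[q0 /not_implyP[Aq0 /eqP nz_q0]].
  pose S k := `[< exists q, [/\ A q, q != 0 & size q = k] >].
  have exS : exists k, S k by exists (size q0); apply/asboolP; exists q0.
  case: (ex_minnP exS) => k /asboolP[a [Aa nz_a sz_a]] min_k.
  have [c rac] : exists c, root a c.
    apply/closed_rootP; apply: contra_notN A1 => /size_poly1P[c nz_c def_a].
    have := AM c^-1%:P _ Aa; rewrite def_a -polyCM mulVf //.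
  exists c => q Aq; rewrite (divp_eq q a) hornerD hornerM (rootP rac) mulr0 add0r.
  suff -> : q %% a = 0 by rewrite horner0.
  apply/eqP; apply: contraT => nz_r; have := ltn_modp q a; rewrite nz_a sz_a ltnNge.
  rewrite min_k //; apply/asboolP; exists (q %% a); split=> //.
  have -> : q %% a = q + - (q %/ a) * a by rewrite {2}(divp_eq q a) mulNr addrC addKr.
  by apply: AA => //; apply: AM.
pose G' z := exists2 P, coefsG P & z = ((map_poly fst P).[x], (map_poly snd P).[c]).
exists c, G'; split; last 2 first.
- move=> [y d] Gy; exists (y, d)%:P; last by rewrite !map_polyC !hornerC.
  by move=> i; rewrite coefC; case: ifP => _ //; apply: pg0.
- exists 'X; last by rewrite !map_polyX !hornerX.
  by move=> i; rewrite coefX; case: (i == 1%N); [apply: pg1 | apply: pg0].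
split.
- by move=> d; exists (iota d, d)%:P; rewrite ?map_polyC ?hornerC.
- move=> _ _ [P GP ->] [Q GQ ->]; exists (P + Q); first exact: GA.
  by rewrite !rmorphD !hornerD.
- move=> _ _ [P GP ->] [Q GQ ->]; exists (P * Q); first exact: GM.
  by rewrite !rmorphM !hornerM.
by move=> d [P GP [/esym Px ->]]; apply: Ac; exists P.
Qed.

End Closure.

(** Zorn's lemma is applied to the sets that become graphs after adding [G0]: in this
    way the empty chain has a bound. *)
Lemma maximal_place G0 : place_graph G0 ->
  exists G, [/\ place_graph G, (G0 `<=` G)%classic
    & forall G', place_graph G' -> (G `<=` G')%classic -> (G' `<=` G)%classic].
Proof.
move=> pG0; have [F FP totF | A [pA maxA]] :=
    @Zorn_bigcup _ (fun A => place_graph (A `|` G0)%classic); last first.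
  exists (A `|` G0)%classic; split; [exact: pA | by move=> z; right | move=> G' pG' AG' z G'z].
  apply: contrapT => window_sum; apply: (maxA G').
    split=> [y Ay|G'A]; first by apply: AG'; left.
    by apply: window_sum; left; apply: G'A.
  suff -> : (G' `|` G0)%classic = G' by [].
  by apply/seteqP; split=> [y [] // G0y|y]; [apply: AG'; right | left].
set U := (_ `|` G0)%classic.
have joint y z : U y -> U z -> exists G, [/\ place_graph G, (G `<=` U)%classic, G y & G z].
  have inU X : F X -> (X `|` G0 `<=` U)%classic.
    by move=> FX w [Xw | G0w]; [left; exists X | right].
  case=> [[X FX Xy]|G0y] [[Y FY Yz]|G0z].
  - have [XY | YX] := totF X Y FX FY.
      by exists (Y `|` G0)%classic; split; [exact: FP | exact: inU | left; exact: XY | by left].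
    by exists (X `|` G0)%classic; split; [exact: FP | exact: inU | by left | left; exact: YX].
  - by exists (X `|` G0)%classic; split; [exact: FP | exact: inU | by left | by right].
  - by exists (Y `|` G0)%classic; split; [exact: FP | exact: inU | by right | by left].
  by exists G0; split=> // w; right.
split.
- by move=> c; right; apply: pg_const.
- by move=> y z Uy Uz; have [G [pG GU Gy Gz]] := joint y z Uy Uz; apply: GU; apply: pg_add.
- by move=> y z Uy Uz; have [G [pG GU Gy Gz]] := joint y z Uy Uz; apply: GU; apply: pg_mul.
by move=> c Uc; have [G [pG _ Gc _]] := joint _ _ Uc Uc; apply: pg_fun pG _ Gc.
Qed.

Record place := Place { graph_of : set (K * C); graph_ofP : place_graph graph_of }.

Definition place_pred (P : place) : {pred K * C} := fun z => `[< graph_of P z >].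

Fact place_subring P : subring_closed (place_pred P).
Proof.
have pP := graph_ofP P; split; first exact/asboolP/(pg1 pP).
  move=> y z /asboolP Py /asboolP Pz; apply/asboolP.
  by apply: (pg_add pP) => //; apply: pgN.
by move=> y z /asboolP Py /asboolP Pz; apply/asboolP; apply: (pg_mul pP).
Qed.

HB.instance Definition _ P :=
  GRing.isSubringClosed.Build (K * C)%type (place_pred P) (place_subring P).

(** The subring is realized inside [K * C], where its elements carry both their value in
    [K] and their residue in [C]. *)
Record vring (P : place) := Vring { vval : K * C; _ : vval \in place_pred P }.

HB.instance Definition _ P := [isSub for @vval P].
HB.instance Definition _ P := [Choice of vring P by <:].
HB.instance Definition _ P := [SubChoice_isSubComNzRing of vring P by <:].

Section Projections.
Variable P : place.
Implicit Types o : vring P.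

Definition vcoef o : K := (vval o).1.
Definition vres o : C := (vval o).2.

Fact vconst_subproof c : (iota c, c) \in place_pred P.
Proof. exact/asboolP/(pg_const (graph_ofP P)). Qed.

Definition vconst c := Vring (vconst_subproof c).

Fact vcoef_zmod_morphism : zmod_morphism vcoef. Proof. by []. Qed.
Fact vcoef_monoid_morphism : monoid_morphism vcoef. Proof. by []. Qed.
Fact vres_zmod_morphism : zmod_morphism vres. Proof. by []. Qed.
Fact vres_monoid_morphism : monoid_morphism vres. Proof. by []. Qed.

Fact vconst_zmod_morphism : zmod_morphism vconst.
Proof. by move=> c d; apply: val_inj; congr pair; rewrite /= rmorphB. Qed.

Fact vconst_monoid_morphism : monoid_morphism vconst.
Proof.
split=> [|c d]; apply: val_inj; congr pair; first by rewrite /= rmorph1.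
by rewrite /= rmorphM.
Qed.

HB.instance Definition _ :=
  GRing.isZmodMorphism.Build (vring P) K vcoef vcoef_zmod_morphism.
HB.instance Definition _ :=
  GRing.isMonoidMorphism.Build (vring P) K vcoef vcoef_monoid_morphism.
HB.instance Definition _ :=
  GRing.isZmodMorphism.Build (vring P) C vres vres_zmod_morphism.
HB.instance Definition _ :=
  GRing.isMonoidMorphism.Build (vring P) C vres vres_monoid_morphism.
HB.instance Definition _ :=
  GRing.isZmodMorphism.Build C (vring P) vconst vconst_zmod_morphism.
HB.instance Definition _ :=
  GRing.isMonoidMorphism.Build C (vring P) vconst vconst_monoid_morphism.

Lemma vcoef_inj : injective vcoef.
Proof.
move=> o o' /eqP; rewrite -subr_eq0 -rmorphB => /eqP oo'; apply/eqP.
rewrite -subr_eq0; apply/eqP/val_inj; case: (o - o') oo' => -[x c] /= Pxc x0.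
rewrite /vcoef /= in x0; rewrite x0 in Pxc *; congr pair.
by have /asboolP := Pxc; apply: pg_fun (graph_ofP P) _.
Qed.

End Projections.

(** Chevalley's extension theorem for places: a maximal graph is a valuation ring of [K],
    by [place_adjoin] and [maximal_dichotomy]. Its residue field is [C] itself because
    [C] is algebraically closed. *)
Theorem place_extension G0 : place_graph G0 ->
  exists (O : comNzRingType) (val : {rmorphism O -> K}) (res : {rmorphism O -> C})
         (const : {rmorphism C -> O}),
    [/\ injective val, val \o const =1 iota, res \o const =1 id,
        forall x c, G0 (x, c) -> exists2 o, val o = x & res o = c
      & forall x, exists o, val o = x \/ val o = x^-1].
Proof.
move=> /maximal_place[G [pG G0G maxG]]; pose P := Place pG.
exists (vring P), (@vcoef P), (@vres P), (@vconst P); split=> //.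
- exact: vcoef_inj.
- move=> x c /G0G Gxc; have Pxc : (x, c) \in place_pred P by apply/asboolP.
  by exists (Vring Pxc).
move=> x; have [y no_rel|[c Gxc]|[c Gxc]] := maximal_dichotomy pG _ x; last 2 first.
- have Pxc : (x, c) \in place_pred P by apply/asboolP.
  by exists (Vring Pxc); left.
- have Pxc : (x^-1, c) \in place_pred P by apply/asboolP.
  by exists (Vring Pxc); right.
have [c [G' [pG' GG' G'y]]] := place_adjoin pG no_rel.
by exists c; apply: maxG GG' _ G'y.
Qed.

End Places.

(** * Matrices over a valuation ring *)

Section Valuation.
Variables (K : fieldType) (O : comNzRingType) (val : {rmorphism O -> K}).
Hypothesis valuationP : forall x, exists o, val o = x \/ val o = x^-1.
Implicit Types (x y z : K) (o : O).

(** The valuation of [x] is at most that of [y]. *)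
Definition vdvd x y := exists o, y = val o * x.

Lemma vdvd_refl x : vdvd x x.
Proof. by exists 1; rewrite rmorph1 mul1r. Qed.

Lemma vdvd_trans y x z : vdvd x y -> vdvd y z -> vdvd x z.
Proof. by case=> o -> [o' ->]; exists (o' * o); rewrite rmorphM mulrA. Qed.

Lemma vdvd0 x : vdvd x 0.
Proof. by exists 0; rewrite rmorph0 mul0r. Qed.

Lemma vdvdD x y z : vdvd x y -> vdvd x z -> vdvd x (y + z).
Proof. by case=> o -> [o' ->]; exists (o + o'); rewrite rmorphD mulrDl. Qed.

Lemma vdvd_mull x o y : vdvd x y -> vdvd x (val o * y).
Proof. by case=> o' ->; exists (o * o'); rewrite rmorphM mulrA. Qed.

Lemma vdvd_total x y : vdvd x y \/ vdvd y x.
Proof.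
have [-> | nz_x] := eqVneq x 0; first by right; apply: vdvd0.
have [-> | nz_y] := eqVneq y 0; first by left; apply: vdvd0.
have [o [def_o | def_o]] := valuationP (y / x); [left | right]; exists o.
  by rewrite def_o divfK.
by rewrite def_o invf_div divfK.
Qed.

Lemma vdvd_min (I : finType) (f : I -> K) (i0 : I) :
  exists i, forall j, vdvd (f i) (f j).
Proof.
suff [i min_i] : exists i, forall j, j \in enum I -> vdvd (f i) (f j).
  by exists i => j; apply: min_i; rewrite mem_enum.
elim: (enum I) => [|k s [i min_i]]; first by exists i0.
have [ik | ki] := vdvd_total (f i) (f k); [exists i | exists k] => j.
  by rewrite inE => /predU1P[-> | /min_i].
by rewrite inE => /predU1P[-> | /min_i]; [apply: vdvd_refl | apply: vdvd_trans ki].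
Qed.

Lemma vdvd_mulmx m n p x (P : 'M[O]_(m, n)) (A : 'M[K]_(n, p)) :
  (forall i j, vdvd x (A i j)) -> forall i j, vdvd x ((map_mx val P *m A) i j).
Proof.
move=> xA i j; rewrite mxE; elim/big_ind: _ => [||k _]; [exact: vdvd0 | exact: vdvdD |].
by rewrite mxE; apply: vdvd_mull.
Qed.

Lemma vdvd_trmx m n x (A : 'M[K]_(m, n)) :
  (forall i j, vdvd x (A i j)) -> forall i j, vdvd x (A^T i j).
Proof. by move=> xA i j; rewrite mxE. Qed.

Lemma vdvd_mulmxr m n p x (P : 'M[O]_(n, p)) (A : 'M[K]_(m, n)) :
  (forall i j, vdvd x (A i j)) -> forall i j, vdvd x ((A *m map_mx val P) i j).
Proof.
move=> xA i j; rewrite -[_ *m _]trmxK trmx_mul map_trmx.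
exact/vdvd_trmx/vdvd_mulmx/vdvd_trmx.
Qed.

Definition equiv_diag n (A : 'M[K]_n) :=
  exists (P P' Q Q' : 'M[O]_n) (t : 'rV[K]_n),
    [/\ P *m P' = 1%:M, Q *m Q' = 1%:M,
        A = map_mx val P *m diag_mx t *m map_mx val Q
      & forall i j : 'I_n, (i <= j)%N -> vdvd (t 0 i) (t 0 j)].

Lemma equiv_diag_mul n (U U' V V' : 'M[O]_n) (A : 'M[K]_n) :
  U *m U' = 1%:M -> V *m V' = 1%:M ->
  equiv_diag A -> equiv_diag (map_mx val U *m A *m map_mx val V).
Proof.
move=> UU' VV' [P [P' [Q [Q' [t [PP' QQ' -> tP]]]]]].
exists (U *m P), (P' *m U'), (Q *m V), (V' *m Q'), t; split=> //.
- by rewrite mulmxA -(mulmxA U) PP' mulmx1.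
- by rewrite mulmxA -(mulmxA Q) VV' mulmx1.
by rewrite !map_mxM !mulmxA.
Qed.

(** An entry dividing all the others, which exists since divisibility is total, is moved
    to the corner and used as a pivot. It divides the remaining block, hence all the
    later pivots: this is why the diagonal is sorted. *)
Lemma smith_valuation n (A : 'M[K]_n) : equiv_diag A.
Proof.
elim: n A => [|n IHn] A.
  exists 1%:M, 1%:M, 1%:M, 1%:M, 0; split=> [|||[]//]; rewrite ?mulmx1 //.
  by apply/matrixP => -[].
have [[i0 j0] /= min_ij] := vdvd_min (fun ij => A ij.1 ij.2) (0, 0).
pose p i : 'M[O]_n.+1 := tperm_mx 0 i.
have pp i : p i *m p i = 1%:M by rewrite -perm_mxM tperm2 perm_mx1.
have mapp i : map_mx val (p i) = tperm_mx 0 i by rewrite map_perm_mx.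
have ppK i : tperm_mx 0 i *m tperm_mx 0 i = 1%:M :> 'M[K]_n.+1.
  by rewrite -mapp -map_mxM pp map_mx1.
pose B := xrow 0 i0 (xcol 0 j0 A).
have -> : A = map_mx val (p i0) *m B *m map_mx val (p j0).
  by rewrite !mapp /B xrowE xcolE !mulmxA ppK mul1mx -mulmxA ppK mulmx1.
apply: equiv_diag_mul (pp i0) (pp j0) _.
have {min_ij} minB i j : vdvd (B 0 0) (B i j).
  by rewrite !mxE tpermL; have := min_ij (tperm 0 i0 i, tperm 0 j0 j); rewrite /= tpermL.
move: B minB => B; set a := B 0 0 => minB.
have /choice[u uP] i : exists o, B (lift 0 i) 0 = val o * a by apply: minB.
have /choice[v vP] j : exists o, B 0 (lift 0 j) = val o * a by apply: minB.
pose uc : 'cV[O]_n := \col_i u i; pose vr : 'rV[O]_n := \row_j v j.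
pose D : 'M[K]_n := \matrix_(i, j) (B (lift 0 i) (lift 0 j) - val (u i * v j) * a).
have [P [P' [Q [Q' [t [PP' QQ' def_D tP]]]]]] := IHn D.
have at_dvd i : vdvd a (t 0 i).
  have aD k l : vdvd a (D k l).
    rewrite mxE; apply: vdvdD; first exact: minB.
    by rewrite -mulNr -rmorphN; apply/vdvd_mull/vdvd_refl.
  have -> : t 0 i = (map_mx val P' *m D *m map_mx val Q') i i.
    rewrite def_D !mulmxA -map_mxM (mulmx1C PP') map_mx1 mul1mx -mulmxA -map_mxM QQ'.
    by rewrite map_mx1 mulmx1 mxE eqxx.
  exact/vdvd_mulmxr/vdvd_mulmx.
pose U : 'M[O]_(1 + n) := block_mx 1%:M 0 uc 1%:M.
pose U' : 'M[O]_(1 + n) := block_mx 1%:M 0 (- uc) 1%:M.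
pose W : 'M[O]_(1 + n) := block_mx 1%:M vr 0 1%:M.
pose W' : 'M[O]_(1 + n) := block_mx 1%:M (- vr) 0 1%:M.
have UU' : U *m U' = 1%:M.
  rewrite mulmx_block !(mul0mx, mulmx0, mul1mx, mulmx1, addr0, add0r) subrr.
  by rewrite -scalar_mx_block.
have WW' : W *m W' = 1%:M.
  rewrite mulmx_block !(mul0mx, mulmx0, mul1mx, mulmx1, addr0, add0r) addNr.
  by rewrite -scalar_mx_block.
have -> : B = map_mx val U *m (block_mx a%:M 0 0 D : 'M_(1 + n)) *m map_mx val W.
  rewrite /U /W !map_block_mx !map_mx1 !map_mx0 !mulmx_block.
  rewrite !(mul0mx, mulmx0, mul1mx, mulmx1, addr0, add0r).
  rewrite -[LHS](@submxK _ 1 n 1 n).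
  have -> : @ulsubmx _ 1 n 1 n B = a%:M.
    by apply/matrixP=> i j; rewrite !ord1 !mxE mulr1n lshift0.
  have -> : @ursubmx _ 1 n 1 n B = a%:M *m map_mx val vr.
    by apply/matrixP=> i j; rewrite !ord1 mul_scalar_mx !mxE lshift0 rshift1 vP mulrC.
  have -> : @dlsubmx _ 1 n 1 n B = map_mx val uc *m a%:M.
    by apply/matrixP=> i j; rewrite !ord1 mul_mx_scalar !mxE lshift0 rshift1 uP mulrC.
  have -> // : @drsubmx _ 1 n 1 n B = map_mx val uc *m a%:M *m map_mx val vr + D.
  apply/matrixP=> i j; rewrite -mulmxA mul_scalar_mx !mxE !rshift1 big_ord1 !mxE rmorphM.
  by rewrite [a * _]mulrC mulrA addrC subrK.
apply: equiv_diag_mul UU' WW' _.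
exists (block_mx 1%:M 0 0 P : 'M_(1 + n)), (block_mx 1%:M 0 0 P' : 'M_(1 + n)).
exists (block_mx 1%:M 0 0 Q : 'M_(1 + n)), (block_mx 1%:M 0 0 Q' : 'M_(1 + n)).
exists (row_mx a%:M t : 'rV_(1 + n)); split.
- rewrite mulmx_block !(mul0mx, mulmx0, mul1mx, mulmx1, addr0, add0r) PP'.
  by rewrite -scalar_mx_block.
- rewrite mulmx_block !(mul0mx, mulmx0, mul1mx, mulmx1, addr0, add0r) QQ'.
  by rewrite -scalar_mx_block.
- rewrite !map_block_mx !map_mx1 !map_mx0 diag_mx_row !mulmx_block.
  rewrite !(mul0mx, mulmx0, mul1mx, mulmx1, addr0, add0r) -def_D.
  by congr (block_mx _ 0 0 D); apply/matrixP=> i j; rewrite !ord1 !mxE.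
move=> i j; case: (@split_ordP 1 n i) => k -> ; case: (@split_ordP 1 n j) => l -> //=.
- by rewrite !row_mxEl !ord1 => _; apply: vdvd_refl.
- by rewrite row_mxEl row_mxEr !ord1 mxE mulr1n.
- by rewrite ord1 add1n.
by rewrite !row_mxEr leq_add2l; apply: tP.
Qed.

Lemma vdvdM x y x' y' : vdvd x y -> vdvd x' y' -> vdvd (x * x') (y * y').
Proof. by case=> o -> [o' ->]; exists (o * o'); rewrite rmorphM mulrACA. Qed.

(** Write [t i] as a product [x 0 * x 1 * .. * x i] with [x l] in [O] for [l > 0]. The
    exponent of [x l] in a monomial of the [t i] is the sum of the exponents of index at
    least [l]; for [a] it is at most what it is for the constant [e], with equality at
    [l = 0], where [x 0] may fail to be in [O]. *)
Lemma vdvd_heavy n e (t : 'I_n.+1 -> K) (a : 'I_n.+1 -> nat) :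
  (forall i j : 'I_n.+1, (i <= j)%N -> vdvd (t i) (t j)) ->
  (\sum_i a i = n.+1 * e)%N ->
  (forall j, (j <= n.+1)%N -> j * e <= \sum_(i < n.+1 | i < j) a i)%N ->
  vdvd (\prod_i t i ^+ a i) (\prod_i t i ^+ e).
Proof.
move=> tP deg_a heavy.
have /choice[tau tauP] l : exists o, (l < n)%N -> t (inord l.+1) = val o * t (inord l).
  have [lt_ln | _] := ltnP l n; last by exists 0.
  have [|o ->] := tP (inord l) (inord l.+1); last by exists o.
  by rewrite !inordK // ltnW.
pose x l := if l is k.+1 then val (tau k) else t ord0.
have tE k : (k <= n)%N -> t (inord k) = \prod_(l < k.+1) x l.
  elim: k => [|k IHk] lt_kn.
    by rewrite big_ord1 /=; congr t; apply: val_inj; rewrite /= inordK.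
  by rewrite big_ord_recr /= -IHk ?tauP 1?mulrC // ltnW.
pose tail (b : 'I_n.+1 -> nat) l := (\sum_(i < n.+1 | l <= i) b i)%N.
have prodE b : \prod_i t i ^+ b i = \prod_(l < n.+1) x l ^+ tail b l.
  transitivity (\prod_(i < n.+1) \prod_(l < n.+1 | (l <= i)%N) x l ^+ b i).
    apply: eq_bigr => i _; have le_in : (i <= n)%N by rewrite -ltnS.
    rewrite -{1}(inord_val i) tE // -prodrXl.
    by rewrite (big_ord_widen n.+1 (fun l => x l ^+ b i)) //; apply: eq_bigl.
  rewrite (exchange_big_dep xpredT) //=; apply: eq_bigr => l _.
  by rewrite prodrXr.
have splitE b l : (\sum_i b i = \sum_(i < n.+1 | i < l) b i + tail b l)%N.
  rewrite (bigID (fun i : 'I_n.+1 => i < l)%N) /=; congr (_ + _)%N.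
  by apply: eq_bigl => i; rewrite -leqNgt.
have sum_e : (\sum_(i < n.+1) e = n.+1 * e)%N by rewrite sum_nat_const card_ord.
have le_tail l : (l < n.+1)%N -> (tail a l <= tail (fun=> e) l)%N.
  move=> lt_ln; have := splitE a l; have := splitE (fun=> e) l.
  rewrite sum_e deg_a -(big_ord_widen n.+1 (fun=> e)) ?(ltnW lt_ln) // sum_nat_const card_ord.
  by move=> def_e def_a; rewrite -(leq_add2l (l * e)) -def_e def_a leq_add2r heavy ?(ltnW lt_ln).
rewrite !prodE; elim/big_ind2: _ => [||[[|l] lt_l] _]; first exact: vdvd_refl.
- by move=> *; apply: vdvdM.
- suff -> : tail a 0%N = tail (fun=> e) 0%N by apply: vdvd_refl.
  have := splitE a 0%N; have := splitE (fun=> e) 0%N.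
  by rewrite sum_e deg_a !big_pred0 // => -> /addnI.
exists (tau l ^+ (tail (fun=> e) l.+1 - tail a l.+1)).
by rewrite rmorphXn -exprD subnK // le_tail.
Qed.

End Valuation.

(** * Semistability *)

(** The coefficients of a form are linear functions of its coordinates, so polynomials in
    coefficients are among the functions that define the closure. *)
Lemma zariski_closure_coef n (K : fieldType) m (X : dhomog n.+1 K m -> Prop)
    (N : nat) (mon : 'I_N -> 'X_{1..n.+1}) (f : {mpoly K[N]}) :
  zariski_closure X 0 ->
  (forall G : dhomog n.+1 K m, X G -> f.@[fun j => (G : {mpoly _[_]})@_(mon j)] = 0) ->
  f.@[fun=> 0] = 0.
Proof.
move=> clX f0; pose b := vbasis {:dhomog n.+1 K m}.
pose L : N.-tuple {mpoly K[\dim {:dhomog n.+1 K m}]} :=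
  [tuple \sum_(i < \dim {:dhomog n.+1 K m}) (b`_i : {mpoly _[_]})@_(mon j) *: 'X_i | j < N].
have LE (G : dhomog n.+1 K m) j :
    (tnth L j).@[fun i => coord b i G] = (G : {mpoly _[_]})@_(mon j).
  rewrite tnth_mktuple raddf_sum /= {2}(coord_vbasis (memvf G)) linear_sum /=.
  rewrite raddf_sum; apply: eq_bigr => i _ /=.
  by rewrite mevalZ mevalXU mcoeffZ mulrC.
have := clX (f \mPo L); rewrite comp_mpoly_meval => f0'.
rewrite -[RHS]f0' => [|G XG].
  by apply: meval_eq => j; rewrite LE mcoeff0.
by rewrite comp_mpoly_meval -[RHS](f0 G XG); apply: meval_eq => j; rewrite LE.
Qed.

Lemma place_graph_meval (C : closedFieldType) (K : fieldType) (iota : {rmorphism C -> K})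
    G N (x : 'I_N -> K) (c : 'I_N -> C) (f : {mpoly C[N]}) :
  place_graph iota G -> (forall j, G (x j, c j)) ->
  G ((map_mpoly iota f).@[x], f.@[c]).
Proof.
move=> pG Gxc; elim/mpoly_indMX: f => [|j f IHf|d f IHf|f g IHf IHg].
- by rewrite !rmorph1; apply: (pg1 pG).
- rewrite !rmorphM /= map_mpolyX !mevalXU.
  exact: (pg_mul pG (Gxc j) IHf).
- rewrite map_mpolyZ !mevalZ; exact: (pg_mul pG (pg_const pG d) IHf).
by rewrite !rmorphD; apply: (pg_add pG IHf IHg).
Qed.

Section Specialization.
Variables (C : closedFieldType) (M : nat).
Local Notation R := {mpoly C[M]}.
Local Notation L := {fraction R}.

Definition scal (c : C) : L := FracField.tofrac (c%:MP_[M]).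

Fact scal_zmod_morphism : zmod_morphism scal.
Proof. by move=> c d; rewrite /scal !rmorphB. Qed.
Fact scal_monoid_morphism : monoid_morphism scal.
Proof. by split=> [|c d]; rewrite /scal ?rmorph1 ?rmorphM. Qed.
HB.instance Definition _ := GRing.isZmodMorphism.Build C L scal scal_zmod_morphism.
HB.instance Definition _ := GRing.isMonoidMorphism.Build C L scal scal_monoid_morphism.

(** Evaluation at [v] extends to the fractions whose denominator is a power of [D] when
    [D] has value [1] at [v]; describing it by its graph avoids localizing. *)
Definition spec_graph (v : 'I_M -> C) (D : R) : set (L * C) :=
  fun z => exists k (r : R), z.1 * FracField.tofrac (D ^+ k) = FracField.tofrac r
                             /\ r.@[v] = z.2.

Lemma spec_graphP v D : D.@[v] = 1 -> place_graph scal (spec_graph v D).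
Proof.
move=> Dv; split=> [c|[x c] [y d] [k [r [xr rv]]] [l [s [ys sv]]]
  |[x c] [y d] [k [r [xr rv]]] [l [s [ys sv]]] | c [k [r [/= r0 rv]]]].
- by exists 0%N, c%:MP; rewrite expr0 rmorph1 mulr1 mevalC.
- exists (k + l)%N, (r * D ^+ l + s * D ^+ k); split=> /=; rewrite /= in xr ys rv sv.
    rewrite exprD !rmorphD !rmorphM /= -xr -ys mulrDl; congr (_ + _).
      by rewrite mulrA.
    by rewrite [RHS]mulrAC -mulrA.
  by rewrite mevalD !mevalM !rmorphXn /= Dv !expr1n !mulr1 rv sv.
- exists (k + l)%N, (r * s); split=> /=; rewrite /= in xr ys rv sv.
    by rewrite exprD !rmorphM /= -xr -ys mulrACA.
  by rewrite mevalM rv sv.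
move: r0; rewrite mul0r => /esym/eqP; rewrite tofrac_eq0 -rv => /eqP->.
exact: meval0.
Qed.

Lemma spec_graph_frac v D r : D != 0 ->
  spec_graph v D (FracField.tofrac r / FracField.tofrac D, r.@[v]).
Proof.
by move=> nz_D; exists 1%N, r; split=> //=; rewrite expr1 divfK // tofrac_eq0.
Qed.

End Specialization.

Lemma map_scal (C : closedFieldType) M n (F : {mpoly C[n]}) :
  map_mpoly (@scal C M) F =
  map_mpoly (@FracField.tofrac _) (map_mpoly (@mpolyC M C) F).
Proof.
apply/mpolyP=> a; apply: etrans (mcoeff_map_mpoly _ _ _) _.
apply/esym/(etrans (mcoeff_map_mpoly _ _ _)).
exact: congr1 (mcoeff_map_mpoly _ _ _).
Qed.

(** A linear change of coordinates carries the ideal along with its generators. *)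
Lemma lin_subst_ideal n (C : fieldType) (g : seq {mpoly C[n]}) (A B : 'M[C]_n) p :
  A *m B = 1%:M -> in_ideal [seq y \mPo lin_subst A | y <- g] p <->
  in_ideal g (p \mPo lin_subst B).
Proof.
move=> AB; have BA := mulmx1C AB; split.
  elim/in_ideal_ind => [|{}p q gp gq|q y].
  - by rewrite raddf0; apply: in_ideal0.
  - by rewrite comp_mpolyD; apply: in_idealD.
  case/mapP=> z zg ->; rewrite lin_substM (lin_substK AB).
  exact/in_idealMl/in_ideal_mem.
rewrite -{2}[p](lin_substK BA); elim/in_ideal_ind => [|{}p' q gp gq|q y yg].
- by rewrite raddf0; apply: in_ideal0.
- by rewrite comp_mpolyD; apply: in_idealD.
by rewrite lin_substM; apply/in_idealMl/in_ideal_mem/map_f.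
Qed.

Lemma lin_subst_artinian n (C : fieldType) (g : seq {mpoly C[n.+1]}) (A B : 'M[C]_n.+1) :
  A *m B = 1%:M -> artinian g -> artinian [seq y \mPo lin_subst A | y <- g].
Proof.
move=> AB /artinian_hilbert[m g0] i; exists m; apply/(lin_subst_ideal _ _ AB).
have /hilbert_eq0 := g0 m (leqnn m); apply; apply: lin_subst_homog.
by rewrite -[X in X.-homog]mul1n dhomogMn // dhomogX /= mdeg1.
Qed.

Lemma lift_to_max n (K C : fieldType) (O : comNzRingType) (val : {rmorphism O -> K})
    (res : {rmorphism O -> C}) (Q : {mpoly K[n]}) :
  (forall a, exists2 o, val o = Q@_a & res o = 0) ->
  exists2 E : {mpoly O[n]}, map_mpoly val E = Q & map_mpoly res E = 0.
Proof.
move=> small; have /choice[o oP] a : exists o, val o = Q@_a /\ res o = 0.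
  by have [o] := small a; exists o.
exists (\sum_(a <- msupp Q) o a *: 'X_[a]).
  rewrite [RHS]mpolyE raddf_sum; apply: eq_bigr => a _ /=.
  by rewrite map_mpolyZ map_mpolyX; have [-> _] := oP a.
rewrite raddf_sum big1 // => a _ /=.
by rewrite map_mpolyZ; have [_ ->] := oP a; rewrite scale0r.
Qed.

Section Destabilization.
Variables (C : numClosedFieldType) (K : fieldType) (iota : {rmorphism C -> K}).
Variables (O : comNzRingType) (val : {rmorphism O -> K}) (res : {rmorphism O -> C}).
Variable const : {rmorphism C -> O}.
Hypotheses (val_inj : injective val) (val_const : val \o const =1 iota).
Hypotheses (res_const : res \o const =1 id).
Hypothesis valuationP : forall x, exists o, val o = x \/ val o = x^-1.
Variables (n d : nat) (g : seq {mpoly C[n.+1]}) (F : {mpoly C[n.+1]}).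
Hypotheses (d_gt0 : (0 < d)%N) (sz_g : size g = n.+1).
Hypotheses (hg : forall y, y \in g -> y \is d.-homog) (artg : artinian g).
Hypotheses (nz_F : F != 0) (hF : F \is (n.+1 * d.-1).-homog).
Hypothesis Fg : forall p, in_ideal g p -> polar F p = 0.

(** Let [Y = P * diag t * Q] be a Smith form over the valuation ring. As [Q] is
    invertible over this ring, it can be removed, and [P] reduces to an invertible matrix
    over [C]. The reduction of the form after the substitution of [P] is apolar to the
    transformed ideal, so [exists_heavy_monomial] gives a monomial [x^a] whose coefficient
    there is a unit. By [vdvd_heavy] the monomial [t^a] divides the product of the
    [t i ^+ d.-1], which is [det Y ^+ d.-1] up to a unit. So the coefficient of [x^a] after
    the substitution of [P * diag t], divided by [det Y ^+ d.-1], is not in the maximal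
    ideal. *)
Theorem no_destabilizing_place (Y : 'M[K]_n.+1) : \det Y != 0 ->
  ~ forall a, exists2 o,
      val o = (map_mpoly iota F \mPo lin_subst Y)@_a / \det Y ^+ d.-1 & res o = 0.
Proof.
move=> nz_Y small; set e := d.-1 in small.
have [P [P' [Q [Q' [t [PP' QQ' def_Y tP]]]]]] := smith_valuation valuationP Y.
have [|E valE resE] := @lift_to_max _ _ _ _ val res
    ((\det Y ^+ e)^-1 *: (map_mpoly iota F \mPo lin_subst Y)).
  by move=> a; have [o vo ro] := small a; exists o; rewrite // vo mcoeffZ mulrC.
pose F1 := map_mpoly const F \mPo lin_subst P.
have valF1 : map_mpoly val F1 = map_mpoly iota F \mPo lin_subst (map_mx val P).
  rewrite map_lin_subst; congr (_ \mPo _); apply/mpolyP => a.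
  by rewrite !mcoeff_map_mpoly; apply: val_const.
pose p0 := map_mx res P; pose p0' := map_mx res P'.
have p0K : p0 *m p0' = 1%:M by rewrite -map_mxM PP' map_mx1.
have resF1 : map_mpoly res F1 = F \mPo lin_subst p0.
  rewrite map_lin_subst; congr (_ \mPo _); apply/mpolyP => a.
  by rewrite !mcoeff_map_mpoly; apply: res_const.
have p0TK : p0'^T *m p0^T = 1%:M by rewrite -trmx_mul p0K trmx1.
have [||||||a nz_a heavy] := @exists_heavy_monomial n C d
    [seq y \mPo lin_subst p0'^T | y <- g] (F \mPo lin_subst p0) d_gt0.
- by rewrite size_map.
- by move=> _ /mapP[y yg ->]; apply/lin_subst_homog/hg.
- exact: lin_subst_artinian p0TK artg.
- by apply: contraNneq nz_F => F0; rewrite -(lin_substK p0K F) F0 raddf0.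
- exact: lin_subst_homog.
- by move=> p /(lin_subst_ideal _ _ p0TK) /Fg; rewrite polar_lin_subst.
have deg_a : (\sum_i a i = n.+1 * e)%N.
  rewrite -mdegE; apply: (dhomog_mf (lin_subst_homog p0 hF)).
  by rewrite mcoeff_msupp.
have [o def_o] := vdvd_heavy tP deg_a heavy.
pose E' := E \mPo lin_subst Q'.
pose u := \det P * \det Q; pose u' := \det P' * \det Q'.
have uu' : u * u' = 1 by rewrite mulrACA -!det_mulmx PP' QQ' mul1mx det1.
have det_Y : \det Y = val u * \prod_i t 0 i.
  by rewrite def_Y !det_mulmx det_diag !det_map_mx rmorphM mulrAC.
have valE' : val E'@_a = (\det Y ^+ e)^-1 * (val F1@_a * \prod_i t 0 i ^+ a i).
  rewrite -!mcoeff_map_mpoly map_lin_subst valE comp_mpolyZ mcoeffZ lin_subst_comp.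
  congr (_ * _); rewrite def_Y -!mulmxA -map_mxM QQ' map_mx1 mulmx1 -lin_subst_comp.
  by rewrite mcoeff_diag_subst valF1.
have resE' : res E'@_a = 0.
  by rewrite -mcoeff_map_mpoly map_lin_subst resE raddf0 mcoeff0.
have nz_T : \prod_i t 0 i != 0.
  by apply: contraNneq nz_Y => T0; rewrite det_Y T0 mulr0.
have nz_u : val u != 0.
  by apply: contraNneq nz_Y => u0; rewrite det_Y u0 mul0r.
have key : E'@_a * o = F1@_a * u' ^+ e.
  apply: val_inj; rewrite !rmorphM rmorphXn /= valE' -!mulrA [_ * val o]mulrC -def_o.
  rewrite prodrXl det_Y mulrCA; congr (_ * _).
  rewrite exprMn invfM -mulrA mulVf ?expf_neq0 // mulr1.
  apply: (mulfI (expf_neq0 e nz_u)).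
  by rewrite mulfV ?expf_neq0 // -exprMn -rmorphM uu' rmorph1 expr1n.
have := congr1 res key; rewrite !rmorphM rmorphXn /= resE' mul0r => /esym/eqP.
rewrite -mcoeff_map_mpoly resF1 mulf_eq0 (negbTE nz_a) expf_eq0 => /andP[_ /eqP u'0].
by have /eqP := congr1 res uu'; rewrite rmorphM u'0 mulr0 rmorph1 eq_sym oner_eq0.
Qed.

End Destabilization.

Section Semistability.
Variables (C : numClosedFieldType) (n d : nat) (g : seq {mpoly C[n.+1]}).
Hypotheses (d_gt0 : (0 < d)%N) (sz_g : size g = n.+1).
Hypotheses (hg : forall y, y \in g -> y \is d.-homog) (artg : artinian g).
Local Notation m := (n.+1 * d.-1)%N.
Local Notation M := (n.+1 * n.+1)%N.

Definition generic_mx : 'M[{mpoly C[M]}]_n.+1 := \matrix_(i, j) 'X_(mxvec_index i j).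

Definition mx_point (A : 'M[C]_n.+1) : 'I_M -> C := fun k => mxvec A 0 k.

Lemma meval_generic A : map_mx (meval (mx_point A)) generic_mx = A.
Proof. by apply/matrixP=> i j; rewrite !mxE mevalXU /mx_point mxvecE. Qed.

Lemma det_meval_generic A : (\det generic_mx).@[mx_point A] = \det A.
Proof. by rewrite -[in RHS](meval_generic A) det_map_mx. Qed.

(** A form [F] in [n.+1] variables has degree [n.+1 * d.-1] here, so dividing by the power
    [d.-1] of the determinant normalizes a substitution to determinant [1]. If the closure
    of the orbit contained [0], sending the normalized coefficients of the generic
    transform of [F] to [0] would be a well-defined morphism, since any polynomial that
    vanishes at them vanishes on the orbit. It extends to a place, in contradiction with
    [no_destabilizing_place]. *)
Theorem annihilator_semistable (F : dhomog n.+1 C m) : F != 0 ->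
  (forall p, in_ideal g p -> polar F p = 0) -> ~ zariski_closure (SL_orbit F) 0.
Proof.
move=> nz_F Fg cl0; pose e := d.-1.
pose D := \det generic_mx ^+ e.
have nz_det : \det generic_mx != 0.
  apply/eqP => det0; have := det_meval_generic 1%:M.
  by rewrite det0 meval0 det1 => /esym/eqP; rewrite oner_eq0.
have nz_D : D != 0 by rewrite expf_neq0.
pose J : finType := 'X_{1..n.+1 < m.+1}.
pose mon (j : 'I_#|J|) : 'X_{1..n.+1} := enum_val j.
pose FY := map_mpoly (@mpolyC M C) F \mPo lin_subst generic_mx.
pose x j : {fraction {mpoly C[M]}} :=
  FracField.tofrac FY@_(mon j) / FracField.tofrac D.
pose G0 : set ({fraction {mpoly C[M]}} * C) := fun z =>
  exists f : {mpoly C[#|J|]}, z = ((map_mpoly (@scal C M) f).@[x], f.@[fun=> 0]).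
have pG0 : place_graph (@scal C M) G0.
  split=> [c|_ _ [f ->] [h ->]|_ _ [f ->] [h ->]|c [f [f0 ->]]].
  - by exists c%:MP; rewrite map_mpolyC !mevalC.
  - by exists (f + h); rewrite !rmorphD.
  - by exists (f * h); rewrite !rmorphM.
  apply: (zariski_closure_coef cl0 (mon := mon)) => G [A detA ->].
  set B := invmx A; have detB : \det B = 1 by rewrite det_inv detA invr1.
  have Dv : D.@[mx_point B] = 1 by rewrite rmorphXn /= det_meval_generic detB expr1n.
  have pS := spec_graphP Dv.
  apply: (pg_fun pS); rewrite {1}f0.
  apply: place_graph_meval pS _ => j.
  have -> : (dual_act A F : {mpoly _[_]})@_(mon j) = (FY@_(mon j)).@[mx_point B].
    rewrite -(mcoeff_map_mpoly (meval (mx_point B))) map_lin_subst meval_generic.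
    congr (mcoeff _ _); congr (_ \mPo _); apply/mpolyP => a.
    by rewrite !mcoeff_map_mpoly /= mevalC.
  exact: spec_graph_frac.
have [O [val [res [const [val_inj val_const res_const G0O valuationP]]]]] :=
  place_extension pG0.
have nz_F' : (F : {mpoly C[n.+1]}) != 0 by [].
apply: (@no_destabilizing_place C _ (@scal C M) O val res const val_inj val_const
  res_const valuationP n d g F d_gt0 sz_g hg artg nz_F' (dhomog_is_dhomog F) Fg
  (map_mx (@FracField.tofrac _) generic_mx)).
  by rewrite det_map_mx tofrac_eq0.
have FYE : map_mpoly (@scal C M) F \mPo lin_subst (map_mx (@FracField.tofrac _) generic_mx)
    = map_mpoly (@FracField.tofrac _) FY.
  rewrite /FY map_lin_subst -map_scal; reflexivity.
move=> a; rewrite FYE mcoeff_map_mpoly det_map_mx.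
have [lt_a | ge_a] := ltnP (mdeg a) m.+1; last first.
  have -> : FY@_a = 0.
    apply: (@dhomog_nemf_coeff _ _ mdeg m); last by rewrite gtn_eqF.
    apply: lin_subst_homog; apply/dhomogP => b; rewrite mcoeff_msupp mcoeff_map_mpoly => Fb.
    apply: (dhomog_mf (dhomog_is_dhomog F)); rewrite mcoeff_msupp.
    by apply: contraNneq Fb => ->; apply/eqP/mpolyC0.
  exists 0; last exact: rmorph0.
  apply: etrans (rmorph0 val) _; apply/esym.
  exact: etrans (congr1 (fun z => z / _) (tofrac0 _)) (mul0r _).
pose j : 'I_#|J| := enum_rank (BMultinom lt_a).
have [|o vo ro] := G0O (x j) 0; first by exists 'X_j; rewrite map_mpolyX !mevalXU.
have xj : x j = FracField.tofrac FY@_a / FracField.tofrac (\det generic_mx) ^+ d.-1.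
  by rewrite /x /mon enum_rankK -tofracXn.
by exists o; [apply: etrans vo xj | apply: ro].
Qed.

End Semistability.

Theorem artinian_associated_form (C : numClosedFieldType) n d
    (g : seq {mpoly C[n.+1]}) : (0 < d)%N -> size g = n.+1 ->
  (forall y, y \in g -> y \is d.-homog) -> artinian g ->
  exists2 A : proj (dhomog n.+1 C (n.+1 * d.-1)),
    is_associated_form d g A & semistable A.
Proof.
move=> d_gt0 sz_g hg artg.
have fg : forms g by move=> y /hg hy; exists d.
have [A assocA] := associated_form_exists fg (hilbert_socle d_gt0 sz_g hg artg).
exists A => // F FA nz_F.
apply: (annihilator_semistable d_gt0 sz_g hg artg nz_F) => p gp.
rewrite -(polar_pihomog p (dhomog_is_dhomog F)).
apply: (proj1 (assocA F) FA); first exact: pihomogP.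
exact: in_ideal_pihomog.
Qed.

(* The number of variables is n.+1, i.e. an arbitrary integer >= 1. *)
Theorem theorem1p0p2 (R : realType) (n d : nat) (d_gt0 : (0 < d)%N) :
  (forall g : n.+1.-tuple {mpoly R[i][n.+1]},
     (forall i, tnth g i \is d.-homog) -> regular_seq g ->
     exists2 A : proj (dhomog n.+1 R[i] (n.+1 * d.-1)),
       is_associated_form d g A & semistable A)
  /\
  (forall F : {mpoly R[i][n.+1]},
     F \is d.+1.-homog -> smooth_form F ->
     exists2 A : proj (dhomog n.+1 R[i] (n.+1 * d.-1)),
       is_associated_form d [tuple F^`M(i) | i < n.+1] A & semistable A).
Proof.
split=> [g hg reg_g | F hF smF].
  have hg' y : y \in (g : seq _) -> y \is d.-homog by case/tnthP=> i ->; apply: hg.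
  apply: artinian_associated_form => //; first exact: size_tuple.
  by apply: regular_seq_artinian d_gt0 _ hg' reg_g; apply: size_tuple.
apply: artinian_associated_form => //; first exact: size_tuple.
  by move=> y /tnthP[i ->]; rewrite tnth_mktuple; apply: mderiv_homog.
exact: smooth_artinian d_gt0 hF smF.
Qed.
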